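(* Let $N>1$ be an integer. In $\mathrm{SL}(2,\mathbb{R})^N$, let $\mathcal{H}$ be the hyperbolic locus, $H_P$ the union of all principal components of $\mathcal{H}$, and $\mathcal{S}$ the semidiscrete and inverse-free locus. Then the closure of $\mathcal{H}\setminus H_P$ in $\mathrm{SL}(2,\mathbb{R})^N$ is contained in $\mathcal{S}$.
   Context: $\mathrm{SL}(2,\mathbb{R})^N$ carries the product topology and $\|\cdot\|$ is a matrix norm. An $N$-tuple $(A_1,\dots,A_N)\in\mathrm{SL}(2,\mathbb{R})^N$ is uniformly hyperbolic if there exist constants $\lambda>1$ and $C>0$ such that $\|A_{i_n}A_{i_{n-1}}\cdots A_{i_0}\|\ge C\lambda^n$ for every sequence $(i_n)$ in $\{1,\dots,N\}$ and all $n\in\mathbb{N}$. The hyperbolic locus $\mathcal{H}$ is the set of all uniformly hyperbolic $N$-tuples. For $\mathcal{A}=(A_1,\dots,A_N)$, $\langle\mathcal{A}\rangle$ is the semigroup of matrices generated by $\{A_1,\dots,A_N\}$ (nonempty products). $\mathcal{A}$ is semidiscrete if the matrices in $\langle\mathcal{A}\rangle$ do not accumulate at the identity matrix $I$, and inverse-free if $I\notin\langle\mathcal{A}\rangle$. The semidiscrete and inverse-free locus $\mathcal{S}$ is the set of all $N$-tuples that are both semidiscrete and inverse-free; equivalently $I\notin\overline{\langle\mathcal{A}\rangle}$. A connected component $H$ of $\mathcal{H}$ is principal if for every $(A_1,\dots,A_N)\in H$ there exists $B\in\mathrm{SL}(2,\mathbb{R})$ such that each of the matrices $BA_1B^{-1},\dots,BA_NB^{-1}$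 is, up to multiplication by $\pm1$, a matrix with all entries positive. $H_P$ is the union of all principal components. *)

(* Defs.v *)
From HB Require Import structures.
From mathcomp Require Import all_boot all_order all_algebra.
From mathcomp Require Import all_classical all_reals all_analysis.

Set Implicit Arguments.
Unset Strict Implicit.
Unset Printing Implicit Defensive.

Import Order.TTheory GRing.Theory Num.Theory.
Import numFieldNormedType.Exports.

Local Open Scope classical_set_scope.
Local Open Scope ring_scope.

(* The subtype carries the subspace topology inherited from 'M[R]_2. *)
Definition SL2 (R : realType) : Type :=
  set_type [set A : 'M[R]_2 | \det A = 1].

HB.instance Definition _ (R : realType) := Topological.on (SL2 R).

Definition SL2N (R : realType) (N : nat) : Type := {ptws 'I_N -> SL2 R}.

HB.instance Definition _ (R : realType) (N : nat) := Topological.on (SL2N R N).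

Definition mx (R : realType) (A : SL2 R) : 'M[R]_2 := \val A.

(* Submultiplicativity is not required, so both usual meanings of "matrix norm"
   are covered. *)
Record is_matrix_norm (R : realType) (nrm : 'M[R]_2 -> R) : Prop := {
  mxnorm_triangle : forall A B, nrm (A + B) <= nrm A + nrm B;
  mxnorm_scale : forall (a : R) A, nrm (a *: A) = `|a| * nrm A;
  mxnorm_eq0 : forall A, nrm A = 0 -> A = 0
}.

(* The k-th factor is A_(i_(n-k)): the product is A_(i_n) ... A_(i_0). *)
Definition uniformly_hyperbolic (R : realType) (nrm : 'M[R]_2 -> R) (N : nat)
    (A : SL2N R N) : Prop :=
  exists lambda C : R, [/\ 1 < lambda, 0 < C &
    forall (i : nat -> 'I_N) (n : nat),
      C * lambda ^+ n <= nrm (\prod_(k < n.+1) mx (A (i (n - k)%N)))].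

Definition hyperbolic_locus (R : realType) (nrm : 'M[R]_2 -> R) (N : nat)
  : set (SL2N R N) := [set A | uniformly_hyperbolic nrm A].
Arguments hyperbolic_locus {R} nrm N.

Definition is_component (T : topologicalType) (E H : set T) : Prop :=
  exists2 x, E x & H = connected_component E x.

Definition positive_mx (R : realType) (M : 'M[R]_2) : Prop :=
  forall k l, 0 < M k l.

Definition principal (R : realType) (nrm : 'M[R]_2 -> R) (N : nat)
    (H : set (SL2N R N)) : Prop :=
  is_component (hyperbolic_locus nrm N) H /\
  forall A, H A -> exists B : SL2 R, forall i : 'I_N,
    let M := mx B * mx (A i) * (mx B)^-1 in
    positive_mx M \/ positive_mx (- M).

Definition principal_locus (R : realType) (nrm : 'M[R]_2 -> R) (N : nat)
  : set (SL2N R N) := \bigcup_(H in [set H | principal nrm H]) H.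
Arguments principal_locus {R} nrm N.

Definition semigroup_gen (R : realType) (N : nat) (A : SL2N R N)
  : set 'M[R]_2 :=
  [set M | exists2 s : seq 'I_N, s != [::] & M = \prod_(i <- s) mx (A i)].

Definition semidiscrete (R : realType) (N : nat) (A : SL2N R N) : Prop :=
  ~ limit_point (semigroup_gen A) 1.

Definition inverse_free (R : realType) (N : nat) (A : SL2N R N) : Prop :=
  ~ semigroup_gen A 1.

Definition semidiscrete_inverse_free_locus (R : realType) (N : nat)
  : set (SL2N R N) := [set A | semidiscrete A /\ inverse_free A].
Arguments semidiscrete_inverse_free_locus : clear implicits.

(* Main.v *)
(* If a generated element [g] is close to the identity, with attracting
   direction [e1], then for every generator [h] the arc from [e1] to [h e1] that
   avoids the repelling direction of [g] is filled by the closure of the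
   semigroup orbit of [e1]: near [h e1] this orbit is an image under [h] of the
   orbit near [e1], where its gaps are relatively tiny, and powers of [g] spread
   this over the arc.  Hence the component of [e1] in the orbit closure is an
   invariant arc, and uniform hyperbolicity lets one thicken it to a strictly
   invariant cone.  Having a strictly invariant cone is an open condition; among
   hyperbolic tuples it is equivalent to a closed condition on signs of traces,
   so it propagates to the whole component, which is therefore principal.  Thus
   non-principal tuples stay at a distance from the identity that is locally
   uniform. *)
Require Import Defs.
From mathcomp Require Import all_boot all_order all_algebra.
From mathcomp Require Import all_classical all_reals all_analysis.
From mathcomp Require Import ring lra.
Set Implicit Arguments.
Unset Strict Implicit.
Unset Printing Implicit Defensive.

Import Order.TTheory GRing.Theory Num.Theory.
Import numFieldNormedType.Exports.
Local Open Scope classical_set_scope.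
Local Open Scope ring_scope.

(** * Matrices of order two *)

(** Uniform hyperbolicity enters through the norms of orbits of the first basis vector. Once the
    orbit has been enlarged by powers of [g], no later word can shrink it by more than a fixed
    factor. This bounds all slopes, and it prevents a generator from fixing an extremal slope with
    an eigenvalue below 1; that is why the invariant arc can be thickened to a strictly invariant
    cone.

    The obstacle to a locally uniform distance is that the two eigendirections of a product near the
    identity may be arbitrarily close to each other, so the conjugation that diagonalizes it is not
    under control. The filling argument is therefore stated with quantities that survive: traces of
    the generators, and diagonal entries of the conjugated generators multiplied by [mu ^+ 2 - 1].

    The closed condition on traces is that the trace of each word has the sign of the product of the
    traces of its letters. *)

Lemma ord2P (P : 'I_2 -> Prop) : P 0 -> P 1 -> forall i, P i.
Proof.
move=> P0 P1 i; case: i => -[|[|//]] lt_i.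
- by rewrite (_ : Ordinal lt_i = 0) //; apply/val_inj.
- by rewrite (_ : Ordinal lt_i = 1) //; apply/val_inj.
Qed.

Section Matrix2.
Variable R : realType.
Implicit Types M N P Q : 'M[R]_2.

Lemma sum2 (F : 'I_2 -> R) : \sum_i F i = F 0 + F 1.
Proof.
rewrite !big_ord_recl big_ord0 addr0.
by congr (_ + F _); apply/val_inj.
Qed.

Lemma mul2E M N i j : (M * N) i j = M i 0 * N 0 j + M i 1 * N 1 j.
Proof. by rewrite -mulmxE mxE sum2. Qed.

Lemma det2E M : \det M = M 0 0 * M 1 1 - M 0 1 * M 1 0.
Proof.
rewrite (expand_det_row _ 0) sum2 /cofactor !det_mx11 !mxE /=.
rewrite expr0 expr1 mul1r mulN1r mulrN.
by congr (M 0 0 * M _ _ - M 0 1 * M _ _); apply/val_inj.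
Qed.

Lemma tr2E M : \tr M = M 0 0 + M 1 1.
Proof. by rewrite /mxtrace sum2. Qed.

Lemma matrix2P M N : M 0 0 = N 0 0 -> M 0 1 = N 0 1 -> M 1 0 = N 1 0 ->
  M 1 1 = N 1 1 -> M = N.
Proof. by move=> *; apply/matrixP; apply: ord2P; apply: ord2P. Qed.

Definition mat2 (a b c d : R) : 'M[R]_2 :=
  \matrix_(i, j) (if i == 0 then if j == 0 then a else b
                  else if j == 0 then c else d).

Lemma mat2E a b c d : (mat2 a b c d 0 0 = a) * (mat2 a b c d 0 1 = b) *
  (mat2 a b c d 1 0 = c) * (mat2 a b c d 1 1 = d).
Proof. by rewrite /mat2 !mxE. Qed.

Lemma detM2 M N : \det (M * N) = \det M * \det N.
Proof. by rewrite -mulmxE det_mulmx. Qed.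

Definition mnorm M := `|M 0 0| + `|M 0 1| + `|M 1 0| + `|M 1 1|.

(** Norm of the image of the first basis vector, the quantity followed along orbits. *)
Definition cnorm M := `|M 0 0| + `|M 1 0|.

Lemma cnorm_ge0 M : 0 <= cnorm M.
Proof. by rewrite /cnorm addr_ge0. Qed.

Lemma mnorm_ge0 M : 0 <= mnorm M.
Proof. by rewrite /mnorm !addr_ge0. Qed.

Lemma normDM_le (a b c d : R) : `|a * b + c * d| <= `|a| * `|b| + `|c| * `|d|.
Proof. by rewrite -!normrM ler_normD. Qed.

Lemma mnormM M N : mnorm (M * N) <= mnorm M * mnorm N.
Proof.
rewrite /mnorm !mul2E.
have H1 := normDM_le (M 0 0) (N 0 0) (M 0 1) (N 1 0).
have H2 := normDM_le (M 0 0) (N 0 1) (M 0 1) (N 1 1).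
have H3 := normDM_le (M 1 0) (N 0 0) (M 1 1) (N 1 0).
have H4 := normDM_le (M 1 0) (N 0 1) (M 1 1) (N 1 1).
move: H1 H2 H3 H4 (normr_ge0 (M 0 0)) (normr_ge0 (M 0 1)) (normr_ge0 (M 1 0))
  (normr_ge0 (M 1 1)) (normr_ge0 (N 0 0)) (normr_ge0 (N 0 1))
  (normr_ge0 (N 1 0)) (normr_ge0 (N 1 1)).
set a := `|M 0 0|; set b := `|M 0 1|; set c := `|M 1 0|; set d := `|M 1 1|.
set e := `|N 0 0|; set f := `|N 0 1|; set g := `|N 1 0|; set h := `|N 1 1|.
move=> H1 H2 H3 H4 a0 b0 c0 d0 e0 f0 g0 h0.
have : 0 <= a * g + a * h + b * e + b * f + (c * g + c * h + d * e + d * f).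
  by rewrite !addr_ge0 // mulr_ge0.
nra.
Qed.

Lemma cnormM M N : cnorm (M * N) <= mnorm M * cnorm N.
Proof.
rewrite /cnorm /mnorm !mul2E.
have H1 := normDM_le (M 0 0) (N 0 0) (M 0 1) (N 1 0).
have H3 := normDM_le (M 1 0) (N 0 0) (M 1 1) (N 1 0).
move: H1 H3 (normr_ge0 (M 0 0)) (normr_ge0 (M 0 1)) (normr_ge0 (M 1 0))
  (normr_ge0 (M 1 1)) (normr_ge0 (N 0 0)) (normr_ge0 (N 1 0)).
set a := `|M 0 0|; set b := `|M 0 1|; set c := `|M 1 0|; set d := `|M 1 1|.
set e := `|N 0 0|; set g := `|N 1 0|.
move=> H1 H3 a0 b0 c0 d0 e0 g0.
have : 0 <= a * g + b * e + (c * g + d * e).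
  by rewrite !addr_ge0 // mulr_ge0.
nra.
Qed.

(* The inverse of a unimodular matrix is its adjugate, which has the same
   entries up to sign. *)
Lemma cnorm_le_mulr M N : \det M = 1 -> cnorm N <= mnorm M * cnorm (M * N).
Proof.
move=> detM.
pose M' := mat2 (M 1 1) (- M 0 1) (- M 1 0) (M 0 0).
have -> : mnorm M = mnorm M'.
  by rewrite /mnorm !mat2E !normrN; ring.
have {1}-> : N = M' * (M * N).
  rewrite mulrA (_ : M' * M = 1) ?mul1r //.
  by apply: matrix2P; rewrite mul2E !mat2E !mxE /=; move: detM; rewrite det2E;
    lra.
exact: cnormM.
Qed.

Lemma cnorm_gt0 M : \det M = 1 -> 0 < cnorm M.
Proof.
move=> detM; rewrite lt_neqAle cnorm_ge0 andbT eq_sym.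
apply/eqP => c0; move: detM; rewrite det2E.
have /eqP : `|M 0 0| == 0.
  by move: c0 (normr_ge0 (M 0 0)) (normr_ge0 (M 1 0)); rewrite /cnorm; lra.
have /eqP : `|M 1 0| == 0.
  by move: c0 (normr_ge0 (M 0 0)) (normr_ge0 (M 1 0)); rewrite /cnorm; lra.
by move=> /normr0_eq0 -> /normr0_eq0 ->; lra.
Qed.

End Matrix2.

(** * Growth along words *)

Section Growth.
Variable R : realType.

Lemma bernoulli (x : R) n : 0 <= x -> 1 + n%:R * x <= (1 + x) ^+ n.
Proof.
move=> x0; elim: n => [|n IH]; first by rewrite mul0r addr0 expr0.
rewrite exprS -natr1.
have : 0 <= n%:R * x * x by rewrite !mulr_ge0 // ler0n.
nra.
Qed.

(** Bernoulli's inequality is applied to the square root [1 + y] of [lam]: then [lam ^+ k] is at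
    least the square of [1 + k%:R * y], which is quadratic in [k]. *)
Lemma linear_lt_exp (lam C a b : R) : 1 < lam -> 0 < C ->
  exists K : nat, forall k, (K <= k)%N -> a + b * k%:R < C * lam ^+ k.
Proof.
move=> lam1 C0.
pose y := Num.sqrt lam - 1.
have y0 : 0 < y by rewrite subr_gt0 -[ltLHS]sqrtr1 ltr_sqrt // (lt_trans ltr01).
have lamE : (1 + y) ^+ 2 = lam.
  by rewrite /y addrC subrK sqr_sqrtr // ltW // (lt_trans ltr01).
pose D := (`|a| + `|b| / y + 1) / (C * y).
have D0 : 0 <= D.
  have yW := ltW y0; have CW := ltW C0.
  by apply: divr_ge0; [rewrite !addr_ge0 ?divr_ge0 | rewrite mulr_ge0].
have [K DK] : exists K : nat, D < K%:R.
  by exists (Num.bound D); move: (archi_boundP D0).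
exists K => k Kk.
have DE : D * (C * y) = `|a| + `|b| / y + 1.
  by rewrite divfK // mulf_neq0 // gt_eqF.
have Dk : D < k%:R by rewrite (lt_le_trans DK) // ler_nat.
have k0 : 0 <= k%:R :> R by rewrite ler0n.
set z := 1 + k%:R * y.
have z1 : 1 <= z by rewrite /z lerDl mulr_ge0 // ltW.
have zlam : z ^+ 2 <= lam ^+ k.
  rewrite -lamE -exprM mulnC exprM ler_pXn2r ?nnegrE //.
  - by apply: bernoulli; exact: ltW.
  - by rewrite (le_trans ler01).
  - by rewrite exprn_ge0 // addr_ge0 // ltW.
have Cz : `|a| + `|b| / y + 1 < C * z.
  rewrite -DE (lt_le_trans (_ : _ < C * (k%:R * y))) //.
    by rewrite [ltRHS]mulrCA ltr_pM2r // mulr_gt0.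
  by rewrite ler_pM2l // /z lerDr.
have bk : b * k%:R <= `|b| / y * (k%:R * y).
  by rewrite [k%:R * y]mulrC mulrA divfK ?gt_eqF // ler_wpM2r // ler_norm.
have az : a <= `|a| by rewrite ler_norm.
have a0 := normr_ge0 a.
have b0 : 0 <= `|b| / y by rewrite divr_ge0 // ltW.
have ky0 : 0 <= k%:R * y by rewrite mulr_ge0 // ltW.
apply: (@lt_le_trans _ _ (C * z ^+ 2)); last by rewrite ler_pM2l.
rewrite expr2 mulrA.
have z0 : 0 <= z by rewrite (le_trans ler01).
apply: (@lt_le_trans _ _ ((`|a| + `|b| / y + 1) * z)).
  rewrite /z; nra.
by rewrite ler_wpM2r // ltW.
Qed.

(** Chebyshev polynomials of the second kind at [t / 2], of degrees [n - 1] and [n - 2]: the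
    coefficients of [Z ^+ n] on [Z] and, up to sign, on [1] for a unimodular [Z] of trace [t]. The
    start [(0, -1)] encodes [Z ^+ 0 = 1]. *)
Fixpoint cheb (t : R) n : R * R :=
  if n is n'.+1 then let: (u, v) := cheb t n' in (t * u - v, u) else (0, -1).

Lemma cheb_bound (t : R) n : `|t| <= 2 -> `|(cheb t n).1| <= n%:R.
Proof.
move=> t2.
(* The recursion conserves this quadratic form. For [t] between -2 and 2 the form dominates the
   square of the difference of the absolute values of [u] and [v], so each term exceeds the previous
   one by at most 1 in absolute value. *)
have inv m : let: (u, v) := cheb t m in u ^+ 2 - t * u * v + v ^+ 2 = 1.
  elim: m => [|m] /=; first by ring.
  by case: (cheb t m) => u v <-; ring.
have step m : let: (u, v) := cheb t m in `|u| <= `|v| + 1.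
  have := inv m; case: (cheb t m) => u v uv.
  have tuv : t * u * v <= 2 * `|u| * `|v|.
    rewrite (le_trans (ler_norm _)) // !normrM ler_wpM2r // ler_wpM2r //.
  have u0 := normr_ge0 u; have v0 := normr_ge0 v.
  have := real_normK (num_real u); have := real_normK (num_real v).
  move=> v2 u2.
  have : (`|u| - `|v|) ^+ 2 <= 1 by rewrite sqrrB; lra.
  rewrite leNgt => H; rewrite leNgt; apply/negP => H2; move/negP: H; apply.
  nra.
have key m : `|(cheb t m).1| <= m%:R.
  elim: m => [|m IH]; first by rewrite /= normr0.
  have := step m.+1; move: IH => /=; case: (cheb t m) => u v /= IH.
  by rewrite -natr1; lra.
exact: key.
Qed.

Lemma cayley_hamilton2 (Z : 'M[R]_2) : \det Z = 1 -> Z * Z = \tr Z *: Z - 1.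
Proof.
by rewrite det2E tr2E => detZ; apply: matrix2P; rewrite mul2E !mxE /=; nra.
Qed.

Lemma expr_cheb (Z : 'M[R]_2) n : \det Z = 1 ->
  Z ^+ n = (cheb (\tr Z) n).1 *: Z - (cheb (\tr Z) n).2 *: 1.
Proof.
move=> detZ; elim: n => [|n IH].
  by rewrite expr0 /= scale0r sub0r scaleN1r opprK.
rewrite exprSr IH /=; case: (cheb _ n) => u v /=.
rewrite mulrBl -!scalerAl mul1r cayley_hamilton2 // scalerBr scalerA.
rewrite scalerBl [u * _]mulrC addrAC; congr (_ - _).
Qed.

Lemma mnormZ (a : R) (M : 'M[R]_2) : mnorm (a *: M) = `|a| * mnorm M.
Proof. by rewrite /mnorm !mxE !normrM !mulrDr. Qed.

Lemma mnormB (M N : 'M[R]_2) : mnorm (M - N) <= mnorm M + mnorm N.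
Proof.
rewrite /mnorm !mxE.
have := ler_normB (M 0 0) (N 0 0); have := ler_normB (M 0 1) (N 0 1).
have := ler_normB (M 1 0) (N 1 0); have := ler_normB (M 1 1) (N 1 1).
lra.
Qed.

Lemma mnorm1 : mnorm (1 : 'M[R]_2) = 2.
Proof. by rewrite /mnorm !mxE /= !normr0 normr1; lra. Qed.

Lemma mnorm_expr (Z : 'M[R]_2) n : \det Z = 1 -> `|\tr Z| <= 2 ->
  mnorm (Z ^+ n) <= mnorm Z * n%:R + 2 * (n%:R + 1).
Proof.
move=> detZ trZ; rewrite expr_cheb // (le_trans (mnormB _ _)) // !mnormZ mnorm1.
have b2 : `|(cheb (\tr Z) n).2| <= n%:R + 1.
  case: n => [|n] /=; first by rewrite normrN normr1 add0r.
  have := cheb_bound n trZ; case: (cheb _ n) => u v /= un.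
  by rewrite (le_trans un) // -natr1 -addrA lerDl; lra.
rewrite [mnorm Z * _]mulrC [2 * _]mulrC lerD //.
- by rewrite ler_wpM2r ?mnorm_ge0 ?cheb_bound.
- by rewrite ler_wpM2r.
Qed.

Variables (T : Type) (A : T -> 'M[R]_2).

Definition wprod (s : seq T) : 'M[R]_2 := \prod_(i <- s) A i.

Lemma wprod_nil : wprod [::] = 1.
Proof. by rewrite /wprod big_nil. Qed.

Lemma wprod_cons i s : wprod (i :: s) = A i * wprod s.
Proof. by rewrite /wprod big_cons. Qed.

Lemma wprod_cat s t : wprod (s ++ t) = wprod s * wprod t.
Proof. by rewrite /wprod big_cat. Qed.

Definition wpow n (s : seq T) := flatten (nseq n s).

Lemma wprod_pow n s : wprod (wpow n s) = wprod s ^+ n.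
Proof.
elim: n => [|n IH]; first by rewrite expr0 wprod_nil.
by rewrite /wpow /= wprod_cat -/(wpow n s) IH exprS.
Qed.

Lemma size_wpow n s : size (wpow n s) = (n * size s)%N.
Proof. by elim: n => //= n IH; rewrite size_cat IH mulSn. Qed.

Definition uniform_growth := exists lam C : R, [/\ 1 < lam, 0 < C &
  forall s, C * lam ^+ size s <= mnorm (wprod s)].

Hypothesis detA : forall i, \det (A i) = 1.

Lemma det_wprod s : \det (wprod s) = 1.
Proof.
by elim: s => [|i s IH]; rewrite ?wprod_nil ?det1 // wprod_cons detM2 detA IH mulr1.
Qed.

Hypothesis growth : uniform_growth.

(** Powers of an elliptic or parabolic product would grow at most linearly. *)
Lemma growth_trace s : s <> [::] -> 2 < `|\tr (wprod s)|.
Proof.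
move=> s0; rewrite ltNge; apply/negP => tr2.
have [lam [C [lam1 C0 grow]]] := growth.
have [K HK] := linear_lt_exp 2 (mnorm (wprod s) + 2) lam1 C0.
have := HK K (leqnn _); apply/negP; rewrite -leNgt.
have := mnorm_expr K (det_wprod s) tr2.
rewrite -wprod_pow => H.
apply: (le_trans (le_trans _ (grow (wpow K s)))).
  rewrite ler_pM2l // size_wpow ler_weXn2l ?ltW // leq_pmulr //.
  by case: (s) s0.
by apply: (le_trans H); lra.
Qed.

End Growth.

(** * Norms along orbits have no hills *)

Section Valley.
Variable R : realType.

(** The second column is the vector [(x, y)] turned by a right angle and divided by its squared
    Euclidean norm, which makes the determinant 1; [coframe] is the inverse. *)
Definition frame (x y : R) : 'M[R]_2 :=
  mat2 x (- y / (x ^+ 2 + y ^+ 2)) y (x / (x ^+ 2 + y ^+ 2)).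

Definition coframe (x y : R) : 'M[R]_2 :=
  mat2 (x / (x ^+ 2 + y ^+ 2)) (y / (x ^+ 2 + y ^+ 2)) (- y) x.

Lemma sqn_ge (x y : R) : 1 <= `|x| + `|y| ->
  `|x| + `|y| <= 2 * (x ^+ 2 + y ^+ 2).
Proof.
move=> xy1; have x0 := normr_ge0 x; have y0 := normr_ge0 y.
have := real_normK (num_real x); have := real_normK (num_real y).
move: xy1 x0 y0; set a := `|x|; set b := `|y| => xy1 x0 y0 <- <-.
have := sqr_ge0 (a - b); rewrite sqrrB; nra.
Qed.

Lemma sqn_gt0 (x y : R) : 1 <= `|x| + `|y| -> 0 < x ^+ 2 + y ^+ 2.
Proof. by move=> xy1; have := sqn_ge xy1; lra. Qed.

Lemma frameK (x y : R) : 1 <= `|x| + `|y| -> frame x y * coframe x y = 1.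
Proof.
move/sqn_gt0 => n0; apply: matrix2P; rewrite mul2E !mat2E !mxE /=; field;
  by rewrite gt_eqF.
Qed.

Lemma mnorm_frame (x y K : R) : 1 <= `|x| + `|y| -> `|x| + `|y| <= K ->
  mnorm (frame x y) <= K + 2.
Proof.
move=> xy1 xyK; have n0 := sqn_gt0 xy1.
rewrite /mnorm !mat2E !normrM normrN [in X in X <= _]normfV (gtr0_norm n0).
rewrite (_ : _ + _ = (`|x| + `|y|) + (`|x| + `|y|) / (x ^+ 2 + y ^+ 2)); last by ring.
rewrite lerD // ler_pdivrMr //; exact: sqn_ge.
Qed.

Lemma mnorm_coframe (x y : R) : mnorm (coframe x y) = mnorm (frame x y).
Proof. by rewrite /mnorm !mat2E !mulNr !normrN; ring. Qed.

(** In the frames of a vector and of its image, a unimodular matrix is upper unipotent. The shear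
    [t] is the component along [(x', y')] of the image of the second frame vector; the lower bounds
    on the two vectors keep it comparable to [M]. *)
Lemma frame_step (M : 'M[R]_2) (x y x' y' : R) : \det M = 1 ->
  x' = M 0 0 * x + M 0 1 * y -> y' = M 1 0 * x + M 1 1 * y ->
  1 <= `|x| + `|y| -> 1 <= `|x'| + `|y'| ->
  exists2 t, `|t| <= 4 * mnorm M & M * frame x y = frame x' y' * mat2 1 t 0 1.
Proof.
move=> detM Ex' Ey' xy1 xy1'.
have n0 := sqn_gt0 xy1; have n0' := sqn_gt0 xy1'.
pose t := (x' * (M 0 1 * x - M 0 0 * y) + y' * (M 1 1 * x - M 1 0 * y)) /
  ((x ^+ 2 + y ^+ 2) * (x' ^+ 2 + y' ^+ 2)).
exists t.
  have nn0 : 0 < (x ^+ 2 + y ^+ 2) * (x' ^+ 2 + y' ^+ 2) by rewrite mulr_gt0.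
  rewrite /t normrM normfV (gtr0_norm nn0) ler_pdivrMr //.
  have u0 := normr_ge0 x; have v0 := normr_ge0 y.
  have u0' := normr_ge0 x'; have v0' := normr_ge0 y'.
  have a0 := normr_ge0 (M 0 0); have b0 := normr_ge0 (M 0 1).
  have c0 := normr_ge0 (M 1 0); have d0 := normr_ge0 (M 1 1).
  have H1 : `|M 0 1 * x - M 0 0 * y| <= `|M 0 1| * `|x| + `|M 0 0| * `|y|.
    by rewrite (le_trans (ler_normB _ _)) // !normrM.
  have H2 : `|M 1 1 * x - M 1 0 * y| <= `|M 1 1| * `|x| + `|M 1 0| * `|y|.
    by rewrite (le_trans (ler_normB _ _)) // !normrM.
  have K1 : `|M 0 1 * x - M 0 0 * y| <= mnorm M * (`|x| + `|y|).
    by rewrite (le_trans H1) // /mnorm; nra.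
  have K2 : `|M 1 1 * x - M 1 0 * y| <= mnorm M * (`|x| + `|y|).
    by rewrite (le_trans H2) // /mnorm; nra.
  apply: (@le_trans _ _ (mnorm M * ((`|x| + `|y|) * (`|x'| + `|y'|)))).
    rewrite (le_trans (normDM_le _ _ _ _)) //.
    have := ler_wpM2l u0' K1; have := ler_wpM2l v0' K2; lra.
  rewrite [4 * _]mulrC -mulrA ler_wpM2l ?mnorm_ge0 //.
  have := sqn_ge xy1; have := sqn_ge xy1'; move=> E1 E2.
  have : (`|x| + `|y|) * (`|x'| + `|y'|) <=
    (2 * (x ^+ 2 + y ^+ 2)) * (2 * (x' ^+ 2 + y' ^+ 2)).
    by apply: ler_pM => //; lra.
  lra.
have n00 : x ^+ 2 + y ^+ 2 != 0 by rewrite gt_eqF.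
have n00' : x' ^+ 2 + y' ^+ 2 != 0 by rewrite gt_eqF.
move: detM; rewrite det2E => detM.
apply: matrix2P; rewrite !mul2E !mat2E.
- by rewrite Ex'; ring.
- have -> : M 0 0 * (- y / (x ^+ 2 + y ^+ 2)) + M 0 1 * (x / (x ^+ 2 + y ^+ 2)) =
    (M 0 1 * x - M 0 0 * y) * (x' ^+ 2 + y' ^+ 2) /
    ((x ^+ 2 + y ^+ 2) * (x' ^+ 2 + y' ^+ 2)).
    by field; rewrite n00 n00'.
  have -> : x' * t + - y' / (x' ^+ 2 + y' ^+ 2) * 1 =
   (x' * (x' * (M 0 1 * x - M 0 0 * y) + y' * (M 1 1 * x - M 1 0 * y)) -
    (M 0 0 * M 1 1 - M 0 1 * M 1 0) * y' * (x ^+ 2 + y ^+ 2)) /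
    ((x ^+ 2 + y ^+ 2) * (x' ^+ 2 + y' ^+ 2)).
    by rewrite detM /t; field; rewrite n00 n00'.
  by congr (_ / _); rewrite Ex' Ey'; ring.
- by rewrite Ey'; ring.
- have -> : M 1 0 * (- y / (x ^+ 2 + y ^+ 2)) + M 1 1 * (x / (x ^+ 2 + y ^+ 2)) =
    (M 1 1 * x - M 1 0 * y) * (x' ^+ 2 + y' ^+ 2) /
    ((x ^+ 2 + y ^+ 2) * (x' ^+ 2 + y' ^+ 2)).
    by field; rewrite n00 n00'.
  have -> : y' * t + x' / (x' ^+ 2 + y' ^+ 2) * 1 =
   (y' * (x' * (M 0 1 * x - M 0 0 * y) + y' * (M 1 1 * x - M 1 0 * y)) +
    (M 0 0 * M 1 1 - M 0 1 * M 1 0) * x' * (x ^+ 2 + y ^+ 2)) /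
    ((x ^+ 2 + y ^+ 2) * (x' ^+ 2 + y' ^+ 2)).
    by rewrite detM /t; field; rewrite n00 n00'.
  by congr (_ / _); rewrite Ex' Ey'; ring.
Qed.

Variables (T : Type) (A : T -> 'M[R]_2) (L : R).
Hypothesis detA : forall i, \det (A i) = 1.
Hypothesis growth : uniform_growth A.
Hypothesis L1 : 1 <= L.
Hypothesis LA : forall i, mnorm (A i) <= L.

Local Notation f w := (cnorm (wprod A w)).

Let f_gt0 w : 0 < f w. Proof. exact/cnorm_gt0/det_wprod. Qed.

Lemma cnorm_cons i w : f (i :: w) <= L * f w.
Proof.
by rewrite wprod_cons (le_trans (cnormM _ _)) // ler_wpM2r ?cnorm_ge0.
Qed.

Lemma cnorm_cons_ge i w : f w <= L * f (i :: w).
Proof.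
by rewrite wprod_cons (le_trans (cnorm_le_mulr _ (detA i))) // ler_wpM2r ?cnorm_ge0.
Qed.

Lemma cnorm_cat_le p q : f (p ++ q) <= L ^+ size p * f q.
Proof.
elim: p => [|i p IH] /=; first by rewrite expr0 mul1r.
rewrite (le_trans (cnorm_cons _ _)) // exprS -mulrA ler_wpM2l //.
by rewrite (le_trans ler01).
Qed.

(** Letters act from the left, so time runs from right to left: the path from [q] to [p ++ q] passes
    through [s ++ q] for the suffixes [s] of [p]. *)
Fixpoint above (l : R) (q p : seq T) : Prop :=
  l <= f (p ++ q) /\ (if p is _ :: p' then above l q p' else True).

Lemma above_head l q p : above l q p -> l <= f (p ++ q).
Proof. by case: p => [|i p] []. Qed.

Lemma above_base l q p : above l q p -> l <= f q.
Proof. by elim: p => [|i p IH] [] // _ /IH. Qed.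

Lemma above_cat l q p1 p2 : above l (p2 ++ q) p1 -> above l q p2 ->
  above l q (p1 ++ p2).
Proof.
by move=> + a2; elim: p1 => [|i p1 IH] //= [h1 /IH]; split; rewrite // -catA.
Qed.

(** Division by [l] makes every vector of the path at least 1 in norm, so [frame_step] applies at
    each letter; unipotent factors compose by adding their shears, whence the bound linear in the
    length. *)
Lemma above_frame l q p : 0 < l -> above l q p ->
  let x := wprod A q 0 0 / l in let y := wprod A q 1 0 / l in
  let x' := wprod A (p ++ q) 0 0 / l in let y' := wprod A (p ++ q) 1 0 / l in
  exists2 t, `|t| <= 4 * L * (size p)%:R &
    wprod A p * frame x y = frame x' y' * mat2 1 t 0 1.
Proof.
move=> l0; have frac w : (l <= f w) -> 1 <= `|wprod A w 0 0 / l| + `|wprod A w 1 0 / l|.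
  by move=> lw; rewrite !normrM normfV (gtr0_norm l0) -mulrDl ler_pdivlMr // mul1r.
elim: p => [_|i p IH [lip /[dup] ap /IH [t tL IHt]]].
  exists 0; first by rewrite normr0 mulr0.
  rewrite wprod_nil mul1r (_ : mat2 1 0 0 1 = 1) ?mulr1 //.
  by apply: matrix2P; rewrite mat2E mxE.
have [||||u uL Hu] := @frame_step (A i) (wprod A (p ++ q) 0 0 / l)
   (wprod A (p ++ q) 1 0 / l) (wprod A (i :: p ++ q) 0 0 / l)
   (wprod A (i :: p ++ q) 1 0 / l) (detA i).
- by rewrite wprod_cons mul2E; ring.
- by rewrite wprod_cons mul2E; ring.
- exact/frac/(above_head ap).
- exact: frac.
exists (u + t).
  have LAi := LA i.
  rewrite (le_trans (ler_normD _ _)) //= -natr1; lra.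
rewrite wprod_cons -mulrA IHt mulrA Hu -mulrA; congr (_ * _).
by apply: matrix2P; rewrite mul2E !mat2E; ring.
Qed.

(** After rescaling, both end vectors have norm between 1 and [L], so their frames are bounded and
    only the linear shear remains. *)
Lemma valley_bound l q p : 0 < l -> above l q p -> f q <= L * l ->
  f (p ++ q) <= L * l ->
  mnorm (wprod A p) <= (L + 2) ^+ 2 * (2 + 4 * L * (size p)%:R).
Proof.
move=> l0 ab fq fpq.
have frac w : (l <= f w) -> 1 <= `|wprod A w 0 0 / l| + `|wprod A w 1 0 / l|.
  by move=> lw; rewrite !normrM normfV (gtr0_norm l0) -mulrDl ler_pdivlMr // mul1r.
have fracL w : (f w <= L * l) -> `|wprod A w 0 0 / l| + `|wprod A w 1 0 / l| <= L.
  by move=> lw; rewrite !normrM normfV (gtr0_norm l0) -mulrDl ler_pdivrMr.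
have [t tL] := above_frame l0 ab.
have q1 := frac _ (above_base ab); have pq1 := frac _ (above_head ab).
have qL := fracL _ fq; have pqL := fracL _ fpq.
set x := _ / l in q1 qL *; set y := _ / l in q1 qL *.
set x' := _ / l in pq1 pqL *; set y' := _ / l in pq1 pqL *.
move=> H.
have -> : wprod A p = frame x' y' * mat2 1 t 0 1 * coframe x y.
  by rewrite -H -mulrA frameK // mulr1.
have F1 := mnorm_frame q1 qL; have F2 := mnorm_frame pq1 pqL.
have U : mnorm (mat2 1 t 0 1) <= 2 + 4 * L * (size p)%:R.
  by rewrite /mnorm !mat2E normr1 normr0; lra.
rewrite (le_trans (mnormM _ _)) // mnorm_coframe.
rewrite [leRHS](_ : _ = (L + 2) * (2 + 4 * L * (size p)%:R) * (L + 2)); last by ring.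
rewrite ler_pM ?mnorm_ge0 // (le_trans (mnormM _ _)) //.
by rewrite ler_pM ?mnorm_ge0.
Qed.

Lemma valley_size : exists K : nat, forall l q p, 0 < l -> above l q p ->
  f q <= L * l -> f (p ++ q) <= L * l -> (size p < K)%N.
Proof.
have [lam [C [lam1 C0 grow]]] := growth.
have [K HK] := linear_lt_exp ((L + 2) ^+ 2 * 2) ((L + 2) ^+ 2 * (4 * L)) lam1 C0.
exists K => l q p l0 ab fq fpq; rewrite ltnNge; apply/negP => /HK.
apply/negP; rewrite -leNgt (le_trans (grow p)) //.
by rewrite (le_trans (valley_bound l0 ab fq fpq)) // mulrDr mulrA.
Qed.

(** Cuts the path at its last visit to the levels at or below [l]. *)
Lemma climb l q p : f q <= l -> l < f (p ++ q) ->
  exists p1 i p2, [/\ p = p1 ++ i :: p2, f (p2 ++ q) <= l &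
    above l (i :: p2 ++ q) p1].
Proof.
move=> fq; elim: p => [|i p IH] lp; first by move: fq lp; lra.
have [/IH [p1 [j [p2 [pE h1 h2]]]]|fp] := ltP l (f (p ++ q)).
  exists (i :: p1), j, p2; split => //=; first by rewrite pE.
  by split => //; move: lp; rewrite /= pE -catA => /ltW.
by exists [::], i, p; split => //=; split => //; exact: ltW.
Qed.

(** Cuts the path at its first return to the levels at or below [l]. *)
Lemma descend l q p : l < f q -> above l q p \/
  exists p1 i p2, [/\ p = p1 ++ i :: p2, f (i :: p2 ++ q) <= l & above l q p2].
Proof.
move=> lq; elim: p => [|i p [ab|[p1 [j [p2 [-> h1 h2]]]]]].
- by left; split => //; exact: ltW.
- have [h|/ltW h] := leP (f (i :: p ++ q)) l.
    by right; exists [::], i, p.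
  by left.
- by right; exists (i :: p1), j, p2.
Qed.

(* The norm along an orbit has no deep hill: a segment between two visits to
   the lowest level would be unipotent up to bounded factors, so its product
   would grow at most linearly. *)
Lemma no_hill : exists2 Lam : R, 1 <= Lam & forall p q,
  Lam * f [::] <= f q -> f q <= Lam * f (p ++ q).
Proof.
have [K HK] := valley_size.
have LK : 1 <= L ^+ K by rewrite exprn_ege1.
(* Fewer than [K] letters above the level cannot lift the norm from [l] beyond [L ^+ K * l]; the
   factor 2 makes the contradiction strict. *)
pose Lam := 2 * L ^+ K.
have Lam1 : 1 < Lam by rewrite /Lam; lra.
have Lam0 : 0 < Lam by rewrite (lt_trans ltr01).
exists Lam; first exact: ltW.
move=> p q lq; rewrite leNgt; apply/negP => fpq.
pose l := f q / Lam.
have lE : Lam * l = f q by rewrite mulrC divfK // gt_eqF.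
have l0 : 0 < l by rewrite divr_gt0.
have nil_l : f [::] <= l by rewrite ler_pdivlMr // mulrC.
have ltl : l < f q by rewrite -lE; nra.
have [|q1 [i [q2 [qE fq2 abq]]]] := @climb l [::] q nil_l.
  by rewrite cats0.
rewrite cats0 in fq2 abq.
have [abp|[p1 [j [p2 [pE fp2 abp]]]]] := @descend l q p ltl.
  have := above_head abp; move: fpq; rewrite -lE; nra.
have ab : above l (i :: q2) (p2 ++ q1).
  by apply: above_cat => //; rewrite -qE.
have /HK : 0 < l by [].
move=> /(_ _ _ ab).
have fb : f (i :: q2) <= L * l.
  by rewrite (le_trans (cnorm_cons _ _)) // ler_wpM2l // (le_trans ler01).
move=> /(_ fb).
(* The next letter [j] brings the norm down to at most [l], so just before it the norm is at most
   [L * l]. *)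
have ft : f ((p2 ++ q1) ++ i :: q2) <= L * l.
  rewrite -catA -qE (le_trans (cnorm_cons_ge j _)) // ler_wpM2l //.
  by rewrite (le_trans ler01).
move=> /(_ ft); rewrite size_cat => szK.
have szq : (size q1 < K)%N by rewrite (leq_ltn_trans _ szK) // leq_addl.
have : f q <= L ^+ (size q1).+1 * l.
  rewrite qE (le_trans (cnorm_cat_le _ _)) // exprSr -mulrA ler_wpM2l //.
  by rewrite exprn_ge0 // (le_trans ler01).
rewrite -lE ler_pM2r // => H.
have : L ^+ (size q1).+1 <= L ^+ K by rewrite ler_weXn2l.
by move: H; rewrite /Lam; lra.
Qed.

Lemma wprod_pow_diag (mu : R) (g : seq T) n : mu != 0 ->
  wprod A g = mat2 mu 0 0 mu^-1 ->
  wprod A (wpow n g) = mat2 (mu ^+ n) 0 0 (mu^-1 ^+ n).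
Proof.
move=> mu0 gE; rewrite wprod_pow gE; elim: n => [|n IH].
  by rewrite !expr0; apply: matrix2P; rewrite mat2E mxE.
by rewrite exprS IH; apply: matrix2P; rewrite mul2E !mat2E ?exprS; ring.
Qed.

(** Letting a power of [g] act first multiplies the norms of the whole orbit by [mu ^+ n]. This
    factor cancels in the conclusion of [no_hill], while it makes the threshold there hold for every
    [q]. *)
Lemma expanding (mu : R) (g : seq T) : 1 < mu ->
  wprod A g = mat2 mu 0 0 mu^-1 ->
  exists2 Lam : R, 1 <= Lam & forall p q, f q <= Lam * f (p ++ q).
Proof.
move=> mu1 gE; have [Lam Lam1 hill] := no_hill.
have mu0 : 0 < mu by rewrite (lt_trans ltr01).
exists Lam => // p q.
have fpow w n : f (w ++ wpow n g) = mu ^+ n * f w.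
  rewrite wprod_cat (wprod_pow_diag n _ gE) ?gt_eqF // /cnorm !mul2E !mat2E.
  by rewrite !mulr0 !addr0 !normrM (gtr0_norm (exprn_gt0 n mu0)); ring.
have [n Hn] := linear_lt_exp (Lam * f [::]) 0 mu1 (f_gt0 q).
have := hill p (q ++ wpow n g).
rewrite catA !fpow mulrCA ler_pM2l ?exprn_gt0 //; apply.
by have := Hn n (leqnn _); rewrite mul0r addr0 [ltRHS]mulrC => /ltW.
Qed.

End Valley.

(** * Slopes of orbits *)

Section Cone.
Variable R : realType.

Lemma exp_big (mu B : R) : 1 < mu -> exists n : nat, B < mu ^+ n.
Proof.
move=> mu1; have [n Hn] := linear_lt_exp B 0 mu1 (@ltr01 R).
by exists n; have := Hn n (leqnn _); rewrite mul0r addr0 mul1r.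
Qed.

Lemma exp_small (nu B : R) : 0 < nu -> nu < 1 -> 0 < B ->
  exists n : nat, nu ^+ n < B.
Proof.
move=> nu0 nu1 B0; have [|n Hn] := @exp_big nu^-1 B^-1; first by rewrite invf_gt1.
by exists n; move: Hn; rewrite exprVn ltf_pV2 // posrE exprn_gt0.
Qed.

Lemma small_quad_gt0 (X Y Z : R) : 0 < X \/ X = 0 /\ 0 < Y ->
  exists2 e : R, 0 < e & forall d, 0 < d -> d < e -> 0 < X + d * Y + d ^+ 2 * Z.
Proof.
move=> H; pose B := `|Y| + `|Z| + 1.
have B0 : 0 < B by rewrite /B ltr_wpDl // addr_ge0.
have [Y1 Z1] : - `|Y| <= Y /\ - `|Z| <= Z by rewrite !lerNnormlW.
have [Y0 Z0] := (normr_ge0 Y, normr_ge0 Z).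
case: H => [X0|[-> Y00]].
  exists (Num.min 1 (X / B)); first by rewrite lt_min ltr01 divr_gt0.
  move=> d d0; rewrite lt_min => /andP[d1]; rewrite ltr_pdivlMr // /B => dX.
  have : d ^+ 2 <= d by rewrite expr2; nra.
  have : 0 <= d ^+ 2 by rewrite sqr_ge0.
  nra.
exists (Y / B); first by rewrite divr_gt0.
move=> d d0; rewrite ltr_pdivlMr // /B => dY.
rewrite add0r expr2 -mulrA -mulrDr mulr_gt0 //; nra.
Qed.

Lemma finite_small (T : finType) (P : T -> R -> Prop) :
  (forall i, exists2 e : R, 0 < e & forall d, 0 < d -> d < e -> P i d) ->
  exists2 e : R, 0 < e & forall d, 0 < d -> d < e -> forall i, P i d.
Proof.
move=> H.
suff [e e0 He] : exists2 e : R, 0 < e & forall d, 0 < d -> d < e ->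
    forall i, i \in enum T -> P i d.
  by exists e => // d d0 de i; apply: He; rewrite ?mem_enum.
elim: (enum T) => [|i s [e e0 IH]]; first by exists 1.
have [e' e'0 He'] := H i.
exists (Num.min e e'); first by rewrite lt_min e0.
move=> d d0; rewrite lt_min => /andP[de de'] j; rewrite inE => /orP[/eqP ->|js].
  exact: He'.
exact: IH.
Qed.

Variables (T : finType) (A : T -> 'M[R]_2) (L mu : R) (g : seq T).
Hypothesis detA : forall i, \det (A i) = 1.
Hypothesis growth : uniform_growth A.
Hypothesis L1 : 1 <= L.
Hypothesis LA : forall i, mnorm (A i) <= L.
Hypothesis mu1 : 1 < mu.
Hypothesis gE : wprod A g = mat2 mu 0 0 mu^-1.

(** Letting [g ^ n] act after [w] multiplies the first coordinate by [mu ^+ n] and divides the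
    second by it. Once [mu ^+ n] exceeds [2 * Lam], the second coordinate contributes at most half
    of itself to the upper bound of [expanding] and can be absorbed. *)
Lemma slope_bound : exists2 K : R, 0 < K &
  forall w, `|wprod A w 1 0| <= K * `|wprod A w 0 0|.
Proof.
have [Lam Lam1 Hexp] := expanding detA growth L1 LA mu1 gE.
have mu0 : 0 < mu by rewrite (lt_trans ltr01).
have [n Hn] := exp_big (2 * Lam) mu1.
exists (2 * Lam * mu ^+ n) => [|w]; first by rewrite !mulr_gt0 ?exprn_gt0 //; lra.
have := Hexp (wpow n g) w.
rewrite wprod_cat (wprod_pow_diag n _ gE) ?gt_eqF // /cnorm !mul2E !mat2E.
rewrite !mul0r addr0 add0r !normrM exprVn normfV !(gtr0_norm (exprn_gt0 n mu0)).
have nn : 0 < mu ^+ n by rewrite exprn_gt0.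
have : Lam * (mu ^+ n)^-1 <= 1 / 2 by rewrite ler_pdivrMr //; lra.
have := normr_ge0 (wprod A w 1 0); have := normr_ge0 (wprod A w 0 0).
nra.
Qed.

Lemma slope_neq0 w : wprod A w 0 0 != 0.
Proof.
apply/eqP => a0; have [K K0 /(_ w)] := slope_bound.
rewrite a0 normr0 mulr0 normr_le0 => /eqP c0.
by have := det_wprod detA w; rewrite det2E a0 c0; lra.
Qed.

Hypothesis apos : forall w, 0 < wprod A w 0 0.

(** Take for [q] the supremum of the slopes. A generator that does not move the direction [(1, q)]
    strictly downwards fixes it, and then slopes just above [q] move down exactly when the
    eigenvalue [al] exceeds 1. The value 1 is excluded by the trace, a smaller value by
    [expanding]. *)
Lemma upper_slope : exists q : R, 
  (forall w, wprod A w 1 0 <= q * wprod A w 0 0) /\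
  exists2 e : R, 0 < e & forall d, 0 < d -> d < e -> forall i,
    0 < A i 0 0 + A i 0 1 * (q + d) /\
    A i 1 0 + A i 1 1 * (q + d) < (q + d) * (A i 0 0 + A i 0 1 * (q + d)).
Proof.
have [Lam Lam1 Hexp] := expanding detA growth L1 LA mu1 gE.
have [K K0 HK] := slope_bound.
pose S : set R := [set wprod A w 1 0 / wprod A w 0 0 | w in [set: seq T]].
have S0 : S !=set0 by exists (wprod A [::] 1 0 / wprod A [::] 0 0), [::].
have Sub : has_ubound S.
  exists K => _ [w _ <-]; rewrite ler_pdivrMr //.
  by rewrite (le_trans (ler_norm _)) // (le_trans (HK w)) // (gtr0_norm (apos w)).
have hS : has_sup S by split.
pose q := sup S.
have wq w : wprod A w 1 0 <= q * wprod A w 0 0.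
  by rewrite -ler_pdivrMr //; apply: ub_le_sup => //; exists w.
have near_q e : 0 < e -> exists w, `|wprod A w 1 0 / wprod A w 0 0 - q| < e.
  move=> e0; have [_ [w _ <-] Hw] := sup_adherent e0 hS.
  exists w; rewrite ltr_norml.
  have := wq w; rewrite -ler_pdivrMr // => Hw'.
  by apply/andP; split; move: Hw; rewrite -/q; lra.
(* Linear inequalities valid on all orbit vectors pass to the limit direction [(1, q)]. *)
have affine x y : (forall w, 0 <= x * wprod A w 0 0 + y * wprod A w 1 0) ->
    0 <= x + y * q.
  move=> H; rewrite leNgt; apply/negP => neg.
  pose e := - (x + y * q) / (`|y| + 1).
  have y1 : 0 < `|y| + 1 by rewrite ltr_wpDl.
  have e0 : 0 < e by rewrite divr_gt0 // oppr_gt0.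
  have [w Hw] := near_q e e0.
  have := H w; have aw := apos w.
  set s := _ / _ in Hw.
  have -> : wprod A w 1 0 = s * wprod A w 0 0 by rewrite divfK // gt_eqF.
  rewrite mulrA -mulrDl pmulr_lge0 // => xys.
  have : y * (s - q) <= `|y| * e.
    rewrite (le_trans (ler_norm _)) // normrM ler_wpM2l //; exact: ltW.
  have : (`|y| + 1) * e = - (x + y * q) by rewrite mulrC divfK // gt_eqF.
  lra.
exists q; split => //; apply: finite_small => i.
have := detA i; rewrite det2E.
set a := A i 0 0; set b := A i 0 1; set c := A i 1 0; set d := A i 1 1 => deti.
(* The image of [(1, q)] under the generator. *)
pose al := a + b * q; pose ga := c + d * q.
have consE w : (wprod A (i :: w) 0 0 = a * wprod A w 0 0 + b * wprod A w 1 0) *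
    (wprod A (i :: w) 1 0 = c * wprod A w 0 0 + d * wprod A w 1 0).
  by rewrite wprod_cons !mul2E.
have al_ge : 0 <= al by apply: affine => w; have := apos (i :: w); rewrite consE; lra.
have gaq : 0 <= q * al - ga.
  have -> : q * al - ga = (q * a - c) + (q * b - d) * q by rewrite /al /ga; ring.
  by apply: affine => w; have := wq (i :: w); rewrite !consE; lra.
have gaK1 : 0 <= K * al - ga.
  have -> : K * al - ga = (K * a - c) + (K * b - d) * q by rewrite /al /ga; ring.
  apply: affine => w; have := HK (i :: w); rewrite (gtr0_norm (apos _)) !consE.
  by rewrite ler_norml => /andP[]; lra.
have gaK2 : 0 <= K * al + ga.
  have -> : K * al + ga = (K * a + c) + (K * b + d) * q by rewrite /al /ga; ring.
  apply: affine => w; have := HK (i :: w); rewrite (gtr0_norm (apos _)) !consE.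
  by rewrite ler_norml => /andP[]; lra.
have al_gt : 0 < al.
  rewrite lt_neqAle al_ge andbT eq_sym; apply/eqP => al0.
  have ga0 : ga = 0 by move: gaK1 gaK2; rewrite al0; lra.
  have : al * d - ga * b = 1 by rewrite -deti /al /ga; ring.
  by rewrite al0 ga0; lra.
(* These are the coefficients of orders 0 and 1 in the excess of slope over [q] for the inequality
   to be proved. In the eigenvector case the second one equals [al - al^-1]. *)
have crit : 0 < q * al - ga \/ q * al - ga = 0 /\ 0 < al + b * q - d.
  have [gap|gaE] : 0 < q * al - ga \/ ga = q * al.
  - by move: gaq; rewrite le_eqVlt => /orP[/eqP|]; [right; lra|left].
  - by left.
  right; split; first by rewrite gaE subrr.
  have char : al * al - (a + d) * al + 1 = 0.
    have e1 : (a - al) + b * q = 0 by rewrite /al; ring.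
    have e2 : c + (d - al) * q = 0 by move: gaE; rewrite /ga; lra.
    have : (a - al) * (d - al) - b * c = 0.
      have -> : (a - al) * (d - al) - b * c =
        ((a - al) + b * q) * (d - al) - b * (c + (d - al) * q) by ring.
      by rewrite e1 e2; ring.
    by rewrite -deti; lra.
  have al1 : 1 < al.
    rewrite ltNge; apply/negP; rewrite le_eqVlt => /orP[/eqP al1|al1].
      have : 2 < `|\tr (wprod A [:: i])| by apply: growth_trace.
      rewrite wprod_cons wprod_nil mulr1 tr2E -/a -/d.
      have -> : a + d = 2 by move: char; rewrite al1; lra.
      by rewrite ger0_norm //; lra.
    (* If [al < 1], a power [F] of the generator contracts [(1, q)], hence also orbit vectors of
       slope close to [q], beyond what [Hexp] allows. The budget is split in halves: [B] for the
       contraction of [(1, q)], [e] below for the error in the slope. *)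
    pose B := 1 / (2 * Lam * (1 + `|q|)).
    have q1 : 0 < 1 + `|q| by rewrite ltr_pwDl.
    have Lq : 0 < 2 * Lam * (1 + `|q|) by rewrite !mulr_gt0 //; lra.
    have B0 : 0 < B by rewrite divr_gt0.
    have [l Hl] := exp_small al_gt al1 B0.
    pose F := wprod A (wpow l [:: i]).
    have FE : F 0 0 + F 0 1 * q = al ^+ l /\ F 1 0 + F 1 1 * q = al ^+ l * q.
      rewrite /F wprod_pow wprod_cons wprod_nil mulr1.
      elim: l {Hl F} => [|l [IH1 IH2]].
        by rewrite !expr0 !mxE /=; split; ring.
      rewrite !exprSr !mul2E -/a -/b -/c -/d; split.
        transitivity ((A i ^+ l) 0 0 * al + (A i ^+ l) 0 1 * ga).
          by rewrite /al /ga; ring.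
        by rewrite -IH1 gaE; ring.
      transitivity ((A i ^+ l) 1 0 * al + (A i ^+ l) 1 1 * ga).
        by rewrite /al /ga; ring.
      by rewrite mulrAC -IH2 gaE; ring.
    pose e := 1 / (2 * Lam * (mnorm F + 1)).
    have F1 : 0 < mnorm F + 1 by rewrite ltr_wpDl // mnorm_ge0.
    have LF : 0 < 2 * Lam * (mnorm F + 1) by rewrite !mulr_gt0 //; lra.
    have e0 : 0 < e by rewrite divr_gt0.
    have [w Hw] := near_q e e0.
    have := Hexp (wpow l [:: i]) w.
    rewrite wprod_cat -/F /cnorm !mul2E.
    set s := _ / _ in Hw; have aw := apos w.
    have -> : wprod A w 1 0 = s * wprod A w 0 0 by rewrite divfK // gt_eqF.
    clearbody s.
    rewrite (_ : F 0 0 * _ + _ = (al ^+ l + F 0 1 * (s - q)) * wprod A w 0 0);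
      last by rewrite -FE.1; ring.
    rewrite (_ : F 1 0 * _ + _ = (al ^+ l * q + F 1 1 * (s - q)) * wprod A w 0 0);
      last by rewrite -FE.2; ring.
    rewrite !normrM (gtr0_norm aw) -mulrDl -[X in X + _]mul1r -mulrDl mulrA ler_pM2r //.
    apply/negP; rewrite -ltNge.
    have H1 : `|al ^+ l + F 0 1 * (s - q)| <= al ^+ l + `|F 0 1| * `|s - q|.
      rewrite (le_trans (ler_normD _ _)) // normrM.
      by rewrite (gtr0_norm (exprn_gt0 l al_gt)).
    have H2 : `|al ^+ l * q + F 1 1 * (s - q)| <= al ^+ l * `|q| + `|F 1 1| * `|s - q|.
      rewrite (le_trans (ler_normD _ _)) // !normrM.
      by rewrite (gtr0_norm (exprn_gt0 l al_gt)).
    have Hl' : Lam * (al ^+ l * (1 + `|q|)) < 1 / 2.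
      move: Hl; rewrite ltr_pdivlMr //; lra.
    have Hw' : Lam * ((mnorm F + 1) * `|s - q|) < 1 / 2.
      move: Hw; rewrite ltr_pdivlMr //; lra.
    have F01 : `|F 0 1| + `|F 1 1| <= mnorm F + 1.
      rewrite /mnorm; have := normr_ge0 (F 0 0); have := normr_ge0 (F 1 0); lra.
    have := normr_ge0 s; have := normr_ge0 (s - q).
    move=> sq0 s0.
    have : (`|F 0 1| + `|F 1 1|) * `|s - q| <= (mnorm F + 1) * `|s - q|.
      by rewrite ler_wpM2r.
    move=> H3.
    have : Lam * (`|al ^+ l + F 0 1 * (s - q)| + `|al ^+ l * q + F 1 1 * (s - q)|) <=
        Lam * (al ^+ l * (1 + `|q|) + (mnorm F + 1) * `|s - q|).
      apply: ler_wpM2l; first exact: le_trans ler01 Lam1.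
      by clear -H1 H2 H3; lra.
    by move: Hl' Hw' s0; clear; lra.
  have -> : al + b * q - d = (al * al - 1) / al.
    apply: (mulIf (lt0r_neq0 al_gt)); rewrite divfK ?gt_eqF //.
    by move: char; rewrite [in X in X -> _]/al; rewrite /al; lra.
  rewrite divr_gt0 // subr_gt0; nra.
have [e1 e10 He1] := @small_quad_gt0 al b 0 (or_introl al_gt).
have [e2 e20 He2] := @small_quad_gt0 (q * al - ga) (al + b * q - d) b crit.
exists (Num.min e1 e2) => [|t t0]; first by rewrite lt_min e10.
rewrite lt_min => /andP[te1 te2]; split.
  by have := He1 t t0 te1; rewrite /al; lra.
by have := He2 t t0 te2; rewrite /al /ga; lra.
Qed.

End Cone.

(** * Strictly invariant cones *)

Section StrictCone.
Variables (R : realType) (T : finType).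
Implicit Types (A : T -> 'M[R]_2) (P Q Z : 'M[R]_2).

(** Conjugation by the diagonal matrix with entries 1 and -1. It negates slopes, so [upper_slope]
    also provides the lower edge of the cone. *)
Definition flip Z : 'M[R]_2 := mat2 (Z 0 0) (- Z 0 1) (- Z 1 0) (Z 1 1).

Lemma flipM Z Z' : flip (Z * Z') = flip Z * flip Z'.
Proof. by apply: matrix2P; rewrite ?mul2E !mat2E !mul2E; ring. Qed.

Lemma mnorm_flip Z : mnorm (flip Z) = mnorm Z.
Proof. by rewrite /mnorm !mat2E !normrN. Qed.

Lemma det_flip Z : \det (flip Z) = \det Z.
Proof. by rewrite !det2E !mat2E; ring. Qed.

Lemma wprod_flip A w : wprod (flip \o A) w = flip (wprod A w).
Proof.
elim: w => [|i w IH].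
  by rewrite !wprod_nil; apply: matrix2P; rewrite mat2E !mxE /= ?oppr0.
by rewrite !wprod_cons IH flipM.
Qed.

Lemma growth_flip A : uniform_growth A -> uniform_growth (flip \o A).
Proof.
move=> [lam [C [lam1 C0 H]]]; exists lam, C; split => // w.
by rewrite wprod_flip mnorm_flip.
Qed.

Lemma strict_cone A (L mu : R) (g : seq T) :
  (forall i, \det (A i) = 1) -> uniform_growth A -> 1 <= L ->
  (forall i, mnorm (A i) <= L) -> 1 < mu -> wprod A g = mat2 mu 0 0 mu^-1 ->
  (forall w, 0 < wprod A w 0 0) ->
  exists P Q, P * Q = 1 /\ forall i, positive_mx (P * A i * Q).
Proof.
move=> detA growth L1 LA mu1 gE apos.
have [q [qub [e e0 He]]] := upper_slope detA growth L1 LA mu1 gE apos.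
have detF i : \det ((flip \o A) i) = 1 by rewrite /= det_flip.
have LF i : mnorm ((flip \o A) i) <= L by rewrite /= mnorm_flip.
have gF : wprod (flip \o A) g = mat2 mu 0 0 mu^-1.
  by rewrite wprod_flip gE; apply: matrix2P; rewrite !mat2E ?oppr0.
have aF w : 0 < wprod (flip \o A) w 0 0 by rewrite wprod_flip mat2E.
have [q' [qub' [e' e'0 He']]] :=
  upper_slope detF (growth_flip growth) L1 LF mu1 gF aF.
have q0 : 0 <= q by have := qub [::]; rewrite wprod_nil !mxE /=; lra.
have q'0 : 0 <= q'.
  by have := qub' [::]; rewrite wprod_nil !mxE /=; lra.
pose t := q + e / 2; pose t' := - (q' + e' / 2).
have {}He i : 0 < A i 0 0 + A i 0 1 * t /\
    A i 1 0 + A i 1 1 * t < t * (A i 0 0 + A i 0 1 * t).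
  by apply: He; lra.
have {}He' i : 0 < A i 0 0 + A i 0 1 * t' /\
    t' * (A i 0 0 + A i 0 1 * t') < A i 1 0 + A i 1 1 * t'.
  have := @He' (e' / 2) _ _ i; rewrite !mat2E => -[||H1 H2]; [lra|lra|].
  by split; rewrite /t'; lra.
have tt' : t' < t by rewrite /t /t'; lra.
clearbody t t'.
have tt0 : 0 < t - t' by rewrite subr_gt0.
(* The columns of the second matrix are positive multiples of the edges [(1, t)] and [(1, t')];
   positive entries mean that both edges are sent into the open cone between them. *)
exists (mat2 (- t') 1 t (-1)), (mat2 (t - t')^-1 (t - t')^-1 (t / (t - t')) (t' / (t - t'))).
split.
  have tt1 : t - t' != 0 by rewrite gt_eqF.
  by apply: matrix2P; rewrite mul2E !mat2E !mxE /=; (ring || field).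
move=> i; have [H1 H2] := He i; have [H3 H4] := He' i.
have := detA i; rewrite det2E.
move: H1 H2 H3 H4; set a := A i 0 0; set b := A i 0 1.
set c := A i 1 0; set d := A i 1 1 => H1 H2 H3 H4 deti.
(* Orientation is preserved: the image of the upper edge keeps the larger slope. This supplies the
   two bounds on the image edges that [He] and [He'] do not give. *)
have cross : (c + d * t) * (a + b * t') - (c + d * t') * (a + b * t) = t - t'.
  by rewrite -[RHS]mul1r -deti; ring.
have H5 : t' * (a + b * t) < c + d * t.
  rewrite -(ltr_pM2r H3); move: (ltr_pM2r H1 (t' * (a + b * t')) (c + d * t')).
  by rewrite H4 => H; lra.
have H6 : c + d * t' < t * (a + b * t').
  rewrite -(ltr_pM2r H1); move: (ltr_pM2r H3 (c + d * t) (t * (a + b * t))).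
  by rewrite H2 => H; lra.
apply: ord2P; apply: ord2P; rewrite !mul2E !mat2E -/a -/b -/c -/d.
- rewrite (_ : _ + _ = (c + d * t - t' * (a + b * t)) / (t - t')); last by ring.
  by rewrite divr_gt0 // subr_gt0.
- rewrite (_ : _ + _ = (c + d * t' - t' * (a + b * t')) / (t - t')); last by ring.
  by rewrite divr_gt0 // subr_gt0.
- rewrite (_ : _ + _ = (t * (a + b * t) - (c + d * t)) / (t - t')); last by ring.
  by rewrite divr_gt0 // subr_gt0.
- rewrite (_ : _ + _ = (t * (a + b * t') - (c + d * t')) / (t - t')); last by ring.
  by rewrite divr_gt0 // subr_gt0.
Qed.

Definition wsign (sg : T -> R) (w : seq T) : R := \prod_(i <- w) sg i.

Lemma wsign_cons sg i w : wsign sg (i :: w) = sg i * wsign sg w.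
Proof. by rewrite /wsign big_cons. Qed.

Lemma norm_wsign sg w : (forall i, `|sg i| = 1) -> `|wsign sg w| = 1.
Proof.
move=> sg1; elim: w => [|i w IH]; first by rewrite /wsign big_nil normr1.
by rewrite wsign_cons normrM sg1 IH mulr1.
Qed.

Lemma wprod_sign sg A w :
  wprod (fun i => sg i *: A i) w = wsign sg w *: wprod A w.
Proof.
elim: w => [|i w IH]; first by rewrite !wprod_nil /wsign big_nil scale1r.
by rewrite !wprod_cons IH wsign_cons -scalerAl -scalerAr scalerA.
Qed.

Definition conj_fam P Q A : T -> 'M[R]_2 := fun i => P * A i * Q.

Lemma wprod_conj P Q A w : P * Q = 1 -> Q * P = 1 ->
  wprod (conj_fam P Q A) w = P * wprod A w * Q.
Proof.
move=> PQ QP; elim: w => [|i w IH]; first by rewrite !wprod_nil mulr1.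
rewrite !wprod_cons IH /conj_fam.
by rewrite -!mulrA [Q * (P * _)]mulrA QP mul1r.
Qed.

Lemma growth_conj P Q A : P * Q = 1 -> Q * P = 1 -> uniform_growth A ->
  uniform_growth (conj_fam P Q A).
Proof.
move=> PQ QP [lam [C [lam1 C0 H]]].
have pos Z Z' : Z * Z' = 1 -> 0 < mnorm Z.
  move=> ZZ; rewrite lt_neqAle mnorm_ge0 andbT eq_sym; apply/eqP => Z0.
  by have := mnormM Z Z'; rewrite ZZ Z0 mnorm1; lra.
have PQ0 : 0 < mnorm Q * mnorm P by rewrite mulr_gt0 ?(pos _ _ PQ) ?(pos _ _ QP).
exists lam, (C / (mnorm Q * mnorm P)); split => //; first by rewrite divr_gt0.
move=> w; rewrite mulrAC ler_pdivrMr //; apply: (le_trans (H w)).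
rewrite wprod_conj // {1}(_ : wprod A w = Q * (P * wprod A w * Q) * P).
  rewrite (le_trans (mnormM _ _)) // [leRHS]mulrA ler_wpM2r ?mnorm_ge0 //.
  by rewrite [leRHS]mulrC mnormM.
by rewrite -!mulrA QP mulr1 mulrA QP mul1r.
Qed.

Lemma det_conj P Q Z : P * Q = 1 -> \det (P * Z * Q) = \det Z.
Proof.
move=> PQ; rewrite !detM2 mulrAC -detM2 PQ det1 mul1r //.
Qed.

Lemma inverse_comm P Q : P * Q = 1 -> Q * P = 1.
Proof. by rewrite -!mulmxE => /mulmx1C. Qed.

Lemma family_bound A : exists2 L : R, 1 <= L & forall i, mnorm (A i) <= L.
Proof.
exists (1 + \sum_i mnorm (A i)).
  by rewrite lerDl sumr_ge0 // => i _; exact: mnorm_ge0.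
move=> i; rewrite (bigD1 i) //= addrCA lerDl addr_ge0 // sumr_ge0 // => j _.
exact: mnorm_ge0.
Qed.

(** Conjugation and signs reduce to [strict_cone]. The word [g] is doubled because its own sign may
    be -1, whereas that of [g ++ g] is 1. *)
Lemma signed_cone A (sg : T -> R) P Q (mu : R) (g : seq T) :
  (forall i, \det (A i) = 1) -> uniform_growth A ->
  (forall i, sg i = 1 \/ sg i = -1) -> P * Q = 1 -> 1 < mu ->
  P * wprod A g * Q = mat2 mu 0 0 mu^-1 ->
  (forall w, 0 < wsign sg w * (P * wprod A w * Q) 0 0) ->
  exists P' Q', P' * Q' = 1 /\
    forall i, positive_mx (P' * A i * Q') \/ positive_mx (- (P' * A i * Q')).
Proof.
move=> detA growth sg1 PQ mu1 gE apos.
have QP := inverse_comm PQ.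
have nsg i : `|sg i| = 1 by case: (sg1 i) => ->; rewrite ?normrN normr1.
pose B i := sg i *: conj_fam P Q A i.
have BE w : wprod B w = wsign sg w *: (P * wprod A w * Q).
  by rewrite wprod_sign wprod_conj.
have detB i : \det (B i) = 1.
  rewrite detZ det_conj // detA mulr1.
  by case: (sg1 i) => ->; rewrite ?sqrrN expr1n.
have growB : uniform_growth B.
  have [lam [C [lam1 C0 H]]] := growth_conj PQ QP growth.
  exists lam, C; split => // w.
  by rewrite wprod_sign mnormZ norm_wsign // mul1r.
have [L L1 LB] := family_bound B.
have mu2 : 1 < mu ^+ 2 by rewrite exprn_egt1.
have sg2 w : wsign sg w * wsign sg w = 1.
  by rewrite -expr2 -(real_normK (num_real _)) norm_wsign // expr1n.
have ggE : wprod B (g ++ g) = mat2 (mu ^+ 2) 0 0 (mu ^+ 2)^-1.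
  rewrite wprod_cat !BE gE -scalerAl -scalerAr scalerA sg2 scale1r.
  have mu0 : mu != 0 by rewrite gt_eqF // (lt_trans ltr01).
  by apply: matrix2P; rewrite mul2E !mat2E; field.
have [|P1 [Q1 [PQ1 H]]] := strict_cone detB growB L1 LB mu2 ggE.
  by move=> w; rewrite BE mxE.
exists (P1 * P), (Q * Q1); split.
  by rewrite -!mulrA [P * (Q * _)]mulrA PQ mul1r.
move=> i; have := H i.
have -> : P1 * B i * Q1 = sg i *: (P1 * P * A i * (Q * Q1)).
  by rewrite /B /conj_fam -scalerAr -scalerAl !mulrA.
by case: (sg1 i) => ->; rewrite ?scale1r ?scaleN1r; [left|right].
Qed.

(** The rows of [P] are left eigenvectors. The formulas for them degenerate when an off-diagonal
    entry vanishes, whence the cases. *)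
Lemma diagonalize Z : \det Z = 1 -> 2 < \tr Z -> exists mu P Q,
  [/\ 1 < mu, P * Q = 1, P * Z * Q = mat2 mu 0 0 mu^-1 & mu + mu^-1 = \tr Z].
Proof.
rewrite det2E tr2E => detZ trZ.
set p := Z 0 0 in detZ trZ *; set q := Z 0 1 in detZ *.
set r := Z 1 0 in detZ *; set s := Z 1 1 in detZ trZ *.
pose D := (p + s) ^+ 2 - 4.
have D0 : 0 < D by rewrite /D; nra.
pose mu := (p + s + Num.sqrt D) / 2.
have sD : Num.sqrt D ^+ 2 = D by rewrite sqr_sqrtr // ltW.
have s0 : 0 < Num.sqrt D by rewrite sqrtr_gt0.
have mu1 : 1 < mu by rewrite /mu; lra.
have mu0 : mu != 0 by rewrite gt_eqF // (lt_trans ltr01).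
have char : mu * mu - (p + s) * mu + 1 = 0.
  rewrite (_ : _ + 1 = (Num.sqrt D ^+ 2 - D) / 4); first by rewrite sD; ring.
  by rewrite /mu /D; field.
have muV : mu^-1 = p + s - mu.
  by apply: (mulfI mu0); rewrite divff //; lra.
have gap : mu - mu^-1 != 0 by rewrite muV /mu gt_eqF //; lra.
suff [P [Q [PQ H]]] : exists P Q, P * Q = 1 /\ P * Z = mat2 mu 0 0 mu^-1 * P.
  exists mu, P, Q; split => //; last by rewrite muV; lra.
  by rewrite H -mulrA PQ mulr1.
have inv (a b c d : R) : a * d - b * c != 0 ->
  mat2 a b c d * mat2 (d / (a * d - b * c)) (- b / (a * d - b * c))
    (- c / (a * d - b * c)) (a / (a * d - b * c)) = 1.
  by move=> n0; apply: matrix2P; rewrite mul2E !mat2E !mxE /=; field.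
have diagE a b c d : a * p + b * r = mu * a -> a * q + b * s = mu * b ->
    c * p + d * r = mu^-1 * c -> c * q + d * s = mu^-1 * d ->
    mat2 a b c d * Z = mat2 mu 0 0 mu^-1 * mat2 a b c d.
  by move=> e1 e2 e3 e4; apply: matrix2P; rewrite !mul2E !mat2E -/p -/q -/r -/s
    ?mul0r ?addr0 ?add0r.
have [r0|r0] := eqVneq r 0; last first.
  exists (mat2 r (mu - p) r (mu^-1 - p)); eexists; split.
    apply: inv; rewrite (_ : _ - _ = r * - (mu - mu^-1)); last by ring.
    by rewrite mulf_neq0 // oppr_eq0.
  apply: diagE; rewrite ?muV; lra.
have ps : p * s = 1 by move: detZ; rewrite r0; lra.
have [q0|q0] := eqVneq q 0; last first.
  exists (mat2 (mu - s) q (mu^-1 - s) q); eexists; split.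
    apply: inv; rewrite (_ : _ - _ = q * (mu - mu^-1)); last by ring.
    by rewrite mulf_neq0.
  apply: diagE; rewrite ?muV ?r0; lra.
have : (mu - p) * (mu - s) = 0 by lra.
move/eqP; rewrite mulf_eq0 !subr_eq0 => /orP[/eqP mup|/eqP mus].
  exists (mat2 1 0 0 1); eexists; split.
    by apply: inv; rewrite mulr1 mulr0 subr0 oner_neq0.
  by apply: diagE; rewrite ?muV ?r0 ?q0; lra.
exists (mat2 0 1 1 0); eexists; split.
  by apply: inv; rewrite mulr1 mul0r sub0r oppr_eq0 oner_neq0.
by apply: diagE; rewrite ?muV ?r0 ?q0; lra.
Qed.

End StrictCone.

(** * Elements near the identity *)

Section NearIdentity.
Variable R : realType.

Lemma scale_between (be al y : R) : 1 < be -> 0 < y -> y <= al ->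
  exists m, be ^+ m * y <= al /\ al < be ^+ m.+1 * y.
Proof.
move=> be1 y0 yal.
have ex : exists m, al < be ^+ m * y.
  by have [n Hn] := exp_big (al / y) be1; exists n; rewrite -ltr_pdivrMr.
case: (ex_minnP ex) => -[|m]; first by rewrite expr0 mul1r; lra.
by move=> H1 H2; exists m; split => //; rewrite leNgt; apply/negP => /H2; rewrite ltnn.
Qed.

(** On slopes the matrix acts by a Moebius map, and [s] is the preimage of [c / a * (1 + p)]. To
    first order [s] is [p * a * c] and the derivative is the inverse square of [a], so a relative
    gap [r] at [s] becomes one of about [p * r], well below [r / 2]. The bound of [s] by [c / a]
    lets an induction be applied at [s]. *)
Lemma fill_step (a b c d p r k : R) :
  a * d - b * c = 1 -> 0 < a -> 0 < c -> 0 < p -> p <= 1 / 8 -> 0 <= r ->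
  p * r * `|b * c| <= 1 / 8 -> p ^+ 2 * `|b * c| <= 1 / 8 ->
  p * (a * `|a + d|) <= 1 / 2 ->
  let s := p * a * c / (1 - p * b * c) in
  [/\ 0 < s, s <= c / a &
   s <= k -> k <= s * (1 + r) ->
   [/\ 0 < a + b * k, c / a * (1 + p) <= (c + d * k) / (a + b * k) &
     (c + d * k) / (a + b * k) <= c / a * (1 + p) * (1 + r / 2)]].
Proof.
move=> det1 a0 c0 p0 p8 r0 prbc p2bc paad s.
have bcE : b * c = a * d - 1 by lra.
have aad : p * (a * (a + d)) <= 1 / 2.
  rewrite (le_trans _ paad) // !ler_wpM2l ?ler_norm //; exact: ltW.
have D0 : 0 < 1 - p * b * c.
  have [bc0|bc0] := leP (b * c) 0.
    have : p * (b * c) <= 0 by rewrite mulr_ge0_le0 // ltW.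
    lra.
  have : p * (b * c) <= p * (a * (a + d)).
    by rewrite ler_wpM2l ?ltW // bcE; nra.
  lra.
set D := 1 - p * b * c in D0 s *.
have Dn : D != 0 by rewrite gt_eqF.
have an : a != 0 by rewrite gt_eqF.
have s0 : 0 < s by rewrite /s divr_gt0 // !mulr_gt0.
split => //.
  rewrite /s ler_pdivrMr // [leRHS]mulrAC ler_pdivlMr //.
  have : p * a * a <= D by rewrite /D; nra.
  by move=> H; rewrite (_ : p * a * c * a = c * (p * a * a)) ?ler_pM2l //; ring.
move=> sk ks.
have as_ : a + b * s = a / D by rewrite /s /D; field.
have cs : c + d * s = c * (1 + p) / D.
  rewrite /s (_ : c * (1 + p) = c * D + p * c * (a * d)).
    by field.
  by rewrite (_ : a * d = 1 + b * c) /D; [ring|lra].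
have aD0 : 0 < a / D by rewrite divr_gt0.
have bk : a / D * (7 / 8) <= a + b * k.
  have : `|b * (k - s)| <= a / D * (1 / 8).
    rewrite normrM (ger0_norm (_ : 0 <= k - s)) ?subr_ge0 //.
    apply: (@le_trans _ _ (`|b| * (s * r))); first by rewrite ler_wpM2l //; lra.
    rewrite (_ : `|b| * (s * r) = a / D * (p * r * (`|b| * c))); last first.
      by rewrite /s; field.
    rewrite ler_wpM2l ?(ltW aD0) //.
    by move: prbc; rewrite normrM (gtr0_norm c0).
  rewrite ler_norml => /andP[H _].
  have : a + b * k = a / D + b * (k - s) by rewrite -as_; ring.
  lra.
have bk0 : 0 < a + b * k by lra.
have bkn : a + b * k != 0 by rewrite gt_eqF.
have diff : (c + d * k) / (a + b * k) - c / a * (1 + p) =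
    (k - s) / ((a + b * k) * (a / D)).
  have -> : c / a * (1 + p) = (c + d * s) / (a + b * s).
    by rewrite cs as_; field; rewrite an Dn.
  have asn : a + b * s != 0 by rewrite as_ gt_eqF.
  rewrite -as_ -[k - s]mulr1 -det1; field.
  by rewrite bkn asn.
split => //.
  by rewrite -subr_ge0 diff divr_ge0 ?subr_ge0 // ltW // mulr_gt0.
have : (k - s) / ((a + b * k) * (a / D)) <= c / a * (1 + p) * (r / 2).
  rewrite ler_pdivrMr; last by rewrite mulr_gt0.
  rewrite (_ : c / a * (1 + p) * (r / 2) * ((a + b * k) * (a / D)) =
    c * (1 + p) / D * (r / 2) * (a + b * k)); last first.
    by field; rewrite Dn an.
  have q0 : 0 <= c * (1 + p) / D * (r / 2).
    by rewrite mulr_ge0 ?divr_ge0 ?mulr_ge0 //; lra.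
  apply: (@le_trans _ _ (c * (1 + p) / D * (r / 2) * (a / D * (7 / 8)))); last first.
    by rewrite ler_wpM2l.
  apply: (@le_trans _ _ (s * r)); first lra.
  have pD : 2 * (p * D) <= 1 / 2.
    have : - (p ^+ 2 * (b * c)) <= p ^+ 2 * `|b * c|.
      by rewrite -mulrN ler_wpM2l ?sqr_ge0 // -normrN ler_norm.
    rewrite /D; lra.
  rewrite (_ : s * r = a * c * r / D ^+ 2 * (p * D)); last by rewrite /s; field.
  rewrite (_ : c * (1 + p) / D * (r / 2) * (a / D * (7 / 8)) =
    a * c * r / D ^+ 2 * ((1 + p) * (7 / 16))); last first.
    by field.
  rewrite ler_wpM2l //; last lra.
  have [aW cW] := (ltW a0, ltW c0).
  by apply: divr_ge0; [rewrite !mulr_ge0|rewrite sqr_ge0].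
rewrite -diff mulrDr mulr1; set X := _ / (a + b * k); lra.
Qed.

(* Near [c / a] the set [K] is the image of [K] near [0], where gaps are
   relatively much smaller than the step of the scaling; scaling back, every
   gap below [c / a] is at most half of itself. *)
Lemma fill (K : R -> Prop) (be a b c d : R) : 1 < be -> be - 1 <= 1 / 8 ->
  a * d - b * c = 1 -> 0 < a -> 0 < c ->
  (be - 1) ^+ 2 * `|b * c| <= 1 / 8 -> (be - 1) * (a * `|a + d|) <= 1 / 2 ->
  K 0 -> (forall s, K s -> K (s / be)) ->
  (forall s, K s -> K ((c + d * s) / (a + b * s))) ->
  forall n y, 0 < y -> y <= c / a ->
  exists k, [/\ K k, y <= k & k <= y * (1 + (be - 1) / 2 ^+ n)].
Proof.
move=> be1 be8 det1 a0 c0 C2 C3 K0 Kbe KM.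
have be0 : 0 < be by rewrite (lt_trans ltr01).
have Kpow m s : K s -> K (s / be ^+ m).
  elim: m => [|m IH] Ks; first by rewrite expr0 divr1.
  by rewrite exprSr invfM mulrA; apply/Kbe/IH.
have Kal : K (c / a) by have := KM _ K0; rewrite !mulr0 !addr0.
have rescale m (x y z : R) : be ^+ m * y <= x -> x <= be ^+ m * y * z ->
    y <= x / be ^+ m /\ x / be ^+ m <= y * z.
  have bm : 0 < be ^+ m by rewrite exprn_gt0.
  rewrite ler_pdivlMr // ler_pdivrMr // [y * be ^+ m]mulrC => H1 H2; split => //.
  by rewrite mulrC mulrA.
elim=> [|n IH] y y0 yal; have [m [H1 H2]] := scale_between be1 y0 yal.
  have [||l1 l2] := rescale m (c / a) y be => //.
    by move: H2; rewrite exprS; lra.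
  by exists (c / a / be ^+ m); split; [exact: Kpow| |rewrite expr0 divr1 addrC subrK].
have al0 : 0 < c / a by rewrite divr_gt0.
(* The exponent [m.+1] is the first that lifts [y] beyond [c / a], so the relative overshoot [p] is
   at most [be - 1]. *)
pose p := be ^+ m.+1 * y / (c / a) - 1.
have pE : c / a * (1 + p) = be ^+ m.+1 * y.
  by rewrite /p addrC subrK mulrC divfK // gt_eqF.
have p0 : 0 < p by rewrite /p subr_gt0 ltr_pdivlMr // mul1r.
have pbe : p <= be - 1.
  by rewrite /p lerD2r ler_pdivrMr // exprS -mulrA ler_pM2l.
pose r := (be - 1) / 2 ^+ n.
have r0 : 0 <= r by rewrite divr_ge0 ?exprn_ge0 //; lra.
have rbe : r <= be - 1.
  rewrite /r ler_pdivrMr ?exprn_gt0 // ler_peMr //; first lra.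
  by rewrite exprn_ege1 // ler1n.
have bc0 := normr_ge0 (b * c).
have prbc : p * r * `|b * c| <= 1 / 8.
  apply: le_trans C2; rewrite ler_wpM2r // expr2; apply: ler_pM => //; exact: ltW.
have p2bc : p ^+ 2 * `|b * c| <= 1 / 8.
  by apply: le_trans C2; rewrite ler_wpM2r // !expr2; apply: ler_pM => //; exact: ltW.
have paad : p * (a * `|a + d|) <= 1 / 2.
  by apply: le_trans C3; rewrite ler_wpM2r // mulr_ge0 // ltW.
(* The value 0 for [k] is a dummy: only the bounds on [s] are taken here, and [k] comes from the
   induction hypothesis at [s]. *)
have [s0 sal _] := fill_step 0 det1 a0 c0 p0 (le_trans pbe be8) r0 prbc p2bc paad.
have [k [Kk sk ks]] := IH _ s0 sal.
have [_ _ /(_ sk ks) [bk0 l1 l2]] :=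
  fill_step k det1 a0 c0 p0 (le_trans pbe be8) r0 prbc p2bc paad.
rewrite pE in l1 l2.
have [e1 e2] := rescale _ _ _ _ l1 l2.
exists ((c + d * k) / (a + b * k) / be ^+ m.+1); split => //.
  exact/Kpow/KM.
by rewrite [2 ^+ n.+1]exprSr invfM mulrA.
Qed.

Variables (T : finType) (A : T -> 'M[R]_2) (L mu : R) (g : seq T).
Hypothesis detA : forall i, \det (A i) = 1.
Hypothesis growth : uniform_growth A.
Hypothesis L1 : 1 <= L.
Hypothesis LA : forall i, mnorm (A i) <= L.
Hypothesis mu1 : 1 < mu.
Hypothesis gE : wprod A g = mat2 mu 0 0 mu^-1.

Definition slope w := wprod A w 1 0 / wprod A w 0 0.

Definition slope_closure y := forall e : R, 0 < e ->
  exists w, `|slope w - y| < e.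

Let a_neq0 w : wprod A w 0 0 != 0.
Proof. exact: slope_neq0 detA growth L1 LA mu1 gE w. Qed.

Lemma slopeK w : wprod A w 1 0 = slope w * wprod A w 0 0.
Proof. by rewrite divfK. Qed.

Lemma wprod00_cons i w : wprod A (i :: w) 0 0 =
  (A i 0 0 + A i 0 1 * slope w) * wprod A w 0 0.
Proof. by rewrite wprod_cons mul2E slopeK; ring. Qed.

Lemma wprod10_cons i w : wprod A (i :: w) 1 0 =
  (A i 1 0 + A i 1 1 * slope w) * wprod A w 0 0.
Proof. by rewrite wprod_cons mul2E slopeK; ring. Qed.

Lemma slope_pole_neq0 i w : A i 0 0 + A i 0 1 * slope w != 0.
Proof.
by apply: contraNneq (a_neq0 (i :: w)); rewrite wprod00_cons => ->; rewrite mul0r.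
Qed.

Lemma slope_cons i w : slope (i :: w) =
  (A i 1 0 + A i 1 1 * slope w) / (A i 0 0 + A i 0 1 * slope w).
Proof.
rewrite {1}/slope wprod00_cons wprod10_cons.
by field; rewrite slope_pole_neq0 a_neq0.
Qed.

Lemma slope_nil : slope [::] = 0.
Proof. by rewrite /slope wprod_nil !mxE mul0r. Qed.

Lemma slope_scale w : slope (g ++ w) = slope w / mu ^+ 2.
Proof.
have mu0 : mu != 0 by rewrite gt_eqF // (lt_trans ltr01).
rewrite /slope wprod_cat gE !mul2E !mat2E; field.
by rewrite a_neq0 mu0.
Qed.

(** At a pole the numerator is nonzero, so words with slopes tending to [y] would be sent to words
    of unbounded slope, against [slope_bound]. *)
Lemma closure_pole_neq0 i y : slope_closure y -> A i 0 0 + A i 0 1 * y != 0.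
Proof.
move=> cly; apply/eqP => al0.
have [K K0 HK] := slope_bound detA growth L1 LA mu1 gE.
have := detA i; rewrite det2E.
move: al0; set a := A i 0 0; set b := A i 0 1; set c := A i 1 0.
set d := A i 1 1 => al0 det1.
have ga0 : c + d * y != 0.
  apply/eqP => ga0; have : (a + b * y) * d - (c + d * y) * b = 1 by lra.
  by rewrite al0 ga0; lra.
pose M := K * `|b| + `|d| + 1.
have M0 : 0 < M by rewrite /M ltr_wpDl // addr_ge0 // mulr_ge0 // ltW.
have e0 : 0 < `|c + d * y| / M by rewrite divr_gt0 // normr_gt0.
have [w Hw] := cly _ e0.
have := HK (i :: w); rewrite wprod00_cons wprod10_cons -/a -/b -/c -/d.
rewrite [in leRHS]normrM [leRHS]mulrA [leLHS]normrM.
rewrite ler_pM2r ?normr_gt0 // => H.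
move: Hw; set s := slope w in H * => Hw.
have E1 : `|a + b * s| = `|b| * `|s - y|.
  by rewrite -normrM; congr `|_|; rewrite -[LHS]subr0 -al0; ring.
have E2 : `|c + d * y| <= `|c + d * s| + `|d| * `|s - y|.
  rewrite -normrM (_ : c + d * y = (c + d * s) - d * (s - y)); last by ring.
  exact: ler_normB.
move: Hw; rewrite ltr_pdivlMr // /M.
rewrite E1 in H; have := normr_ge0 (s - y); lra.
Qed.

Lemma closure_moebius i y : slope_closure y ->
  slope_closure ((A i 1 0 + A i 1 1 * y) / (A i 0 0 + A i 0 1 * y)).
Proof.
move=> cly e e0; have al0 := closure_pole_neq0 i cly.
have := detA i; rewrite det2E.
move: al0; set a := A i 0 0; set b := A i 0 1; set c := A i 1 0.
set d := A i 1 1 => al0 det1.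
set al := a + b * y in al0 *.
have al1 : 0 < `|al| by rewrite normr_gt0.
pose e1 := `|al| / (2 * (`|b| + 1)).
have b1 : 0 < 2 * (`|b| + 1) by rewrite mulr_gt0 // ltr_wpDl.
have e10 : 0 < e1 by rewrite divr_gt0.
pose e2 := e * (`|al| * `|al| / 2).
have e20 : 0 < e2 by rewrite !mulr_gt0.
have [|w] := cly (Num.min e1 e2); first by rewrite lt_min e10.
rewrite lt_min => /andP[Hw1 Hw2].
exists (i :: w); rewrite slope_cons -/a -/b -/c -/d.
have pole := slope_pole_neq0 i w; rewrite -/a -/b in pole.
set s := slope w in Hw1 Hw2 pole *.
have -> : (c + d * s) / (a + b * s) - (c + d * y) / al = (s - y) / ((a + b * s) * al).
  by rewrite -[s - y]mulr1 -det1 /al; field; rewrite pole al0.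
rewrite normrM normfV normrM.
have big : `|al| / 2 <= `|a + b * s|.
  have E : `|al| <= `|a + b * s| + `|b| * `|s - y|.
    rewrite -normrM (_ : al = (a + b * s) - b * (s - y)); last by rewrite /al; ring.
    exact: ler_normB.
  move: Hw1; rewrite ltr_pdivlMr // => H.
  have := normr_ge0 (s - y); lra.
rewrite ltr_pdivrMr; last by rewrite mulr_gt0 ?normr_gt0.
apply: (lt_le_trans Hw2); rewrite /e2 ler_wpM2l ?(ltW e0) //.
by rewrite [leLHS]mulrAC ler_wpM2r.
Qed.

(** The smallness conditions of [fill] for the scaling [mu ^+ 2]. The product of the off-diagonal
    entries is written through the determinant, so that only diagonal entries occur. *)
Hypothesis C1 : mu ^+ 2 - 1 <= 1 / 8.
Hypothesis C2 : forall i,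
  (mu ^+ 2 - 1) ^+ 2 * `|A i 0 0 * A i 1 1 - 1| <= 1 / 8.
Hypothesis C3 : forall i,
  (mu ^+ 2 - 1) * (`|A i 0 0| * `|A i 0 0 + A i 1 1|) <= 1 / 2.

Definition sgn1 (x : R) : R := if 0 < x then 1 else -1.

Lemma sgn1P x : sgn1 x = 1 \/ sgn1 x = -1.
Proof. by rewrite /sgn1; case: ifP; [left|right]. Qed.

Lemma sgn1_mul x : x != 0 -> 0 < sgn1 x * x.
Proof. by rewrite /sgn1 => x0; have [?|?] := ltP 0 x; lra. Qed.

Lemma sgn1_mulE x : x != 0 -> sgn1 x * x = `|x|.
Proof.
rewrite /sgn1 => x0; have [?|?] := ltP 0 x.
  by rewrite gtr0_norm // mul1r.
by rewrite ler0_norm // mulN1r.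
Qed.

(* [0 <= y * (t - y)] says that [y] lies between [0] and [t]. *)
Lemma fill_generator i y : 0 <= y * (A i 1 0 / A i 0 0 - y) -> slope_closure y.
Proof.
move=> yb.
have a0 : A i 0 0 != 0.
  by have := a_neq0 [:: i]; rewrite wprod_cons wprod_nil mulr1.
have be1 : 1 < mu ^+ 2 by rewrite exprn_egt1.
(* A change of sign does not affect the action on slopes and makes the first entry positive. *)
pose sg := sgn1 (A i 0 0).
have sg2 : sg * sg = 1 by case: (sgn1P (A i 0 0)); rewrite /sg => ->; ring.
have := detA i; rewrite det2E; have := C2 i; have := C3 i.
have aE : `|A i 0 0| = sg * A i 0 0 by rewrite /sg sgn1_mulE.
have := sgn1_mul a0; rewrite -/sg.
have := fun s => slope_cons i s.
rewrite aE; have -> : `|A i 0 0 + A i 1 1| = `|sg * A i 0 0 + sg * A i 1 1|.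
  by rewrite -mulrDr normrM (_ : `|sg| = 1) ?mul1r // /sg;
    case: (sgn1P (A i 0 0)) => ->; rewrite ?normrN normr1.
move: yb; set a := A i 0 0; set b := A i 0 1.
set c := A i 1 0; set d := A i 1 1 => yb Hs a0' C3' C2' det1.
have n0 (x : R) : sg * x / (sg * a) = x / a.
  by rewrite -mulf_div divff ?mul1r // /sg; case: (sgn1P a) => ->; rewrite ?oppr_eq0 oner_neq0.
have quot s : (sg * c + sg * d * s) / (sg * a + sg * b * s) = (c + d * s) / (a + b * s).
  rewrite -!mulrA -!mulrDr -mulf_div divff ?mul1r // /sg.
  by case: (sgn1P a) => ->; rewrite ?oppr_eq0 oner_neq0.
have det2 : (sg * a) * (sg * d) - (sg * b) * (sg * c) = 1.
  by rewrite -det1 -[RHS]mul1r -sg2; ring.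
have bcE : sg * b * (sg * c) = a * d - 1.
  by transitivity ((sg * sg) * (b * c)); [ring | rewrite sg2; lra].
have halving (z : R) : 0 < z -> exists n : nat, (mu ^+ 2 - 1) / 2 ^+ n < z.
  move=> z0; have [n Hn] := @exp_big R 2 ((mu ^+ 2 - 1) / z) (ltr1n _ 2).
  exists n; rewrite ltr_pdivrMr ?exprn_gt0 // mulrC -ltr_pdivrMr //.
have [->|y0] := eqVneq y 0.
  by move=> e e0; exists [::]; rewrite slope_nil subr0 normr0.
have [y1|y1] : 0 < y \/ y < 0.
- by move: y0; case: (ltgtP y 0); [right|left|].
- have yal : y <= c / a by move: yb; rewrite pmulr_rge0 // subr_ge0.
  have c0 : 0 < sg * c.
    have : 0 < c / a by lra.
    by rewrite -n0 pmulr_lgt0 // invr_gt0.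
  move=> e e0; have [|n Hn] := halving (e / y); first by rewrite divr_gt0.
  have [||||||k [[w kE] l1 l2]] := @fill (fun s => exists w, s = slope w) (mu ^+ 2)
    (sg * a) (sg * b) (sg * c) (sg * d) be1 C1 det2 a0' c0 _ _ _ _ _ n y y1 => //.
  - by rewrite bcE.
  - by exists [::]; rewrite slope_nil.
  - by move=> _ [w ->]; exists (g ++ w); rewrite slope_scale.
  - by move=> _ [w ->]; exists (i :: w); rewrite slope_cons quot.
  - by rewrite n0.
  exists w; rewrite -kE ger0_norm ?subr_ge0 //.
  move: Hn; rewrite ltr_pdivlMr //; lra.
(* For negative [y], slopes are reflected, which negates [b] and [c]. *)
- have yal : c / a <= y by move: yb; rewrite nmulr_rge0 // subr_le0.
  have c0 : 0 < - (sg * c).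
    have : c / a < 0 by lra.
    by rewrite -n0 oppr_gt0 pmulr_llt0 // invr_gt0.
  have ny : 0 < - y by rewrite oppr_gt0.
  move=> e e0; have [|n Hn] := halving (e / - y); first by rewrite divr_gt0.
  have det3 : (sg * a) * (sg * d) - (- (sg * b)) * (- (sg * c)) = 1.
    by rewrite mulrNN.
  have [||||||k [[w kE] l1 l2]] := @fill (fun s => exists w, - s = slope w) (mu ^+ 2)
    (sg * a) (- (sg * b)) (- (sg * c)) (sg * d) be1 C1 det3 a0' c0 _ _ _ _ _ n (- y) ny => //.
  - by rewrite mulrNN bcE.
  - by exists [::]; rewrite slope_nil oppr0.
  - by move=> s [w sE]; exists (g ++ w); rewrite slope_scale -sE mulNr.
  - move=> s [w sE]; exists (i :: w); rewrite slope_cons -quot -sE.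
    by rewrite -mulNr; congr (_ / _); ring.
  - by rewrite mulNr n0 lerN2.
  exists w; rewrite -kE -normrN opprB opprK addrC ger0_norm; last by lra.
  move: Hn; rewrite ltr_pdivlMr //; lra.
Qed.

Lemma between_cat (al M y : R) : 0 <= y * (M - y) ->
  0 <= y * (al - y) \/ 0 <= (y - al) * (M - y).
Proof.
move=> H; have [|yal] := leP 0 (y * (al - y)); [by left|right].
have [y0|y0|y0] := ltgtP y 0; last by move: yal; rewrite y0 mul0r ltxx.
- have : 0 < al - y by move: yal; rewrite nmulr_rlt0.
  have : M - y <= 0 by move: H; rewrite nmulr_rge0.
  nra.
- have : al - y < 0 by move: yal; rewrite pmulr_rlt0.
  have : 0 <= M - y by move: H; rewrite pmulr_rge0.
  nra.
Qed.

(* The slopes reached by words stay in the component of [0] of the closed set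
   of all slopes, on which no denominator of a generator vanishes. *)
Lemma interval_signs w :
  0 < wsign (fun i => sgn1 (A i 0 0)) w * wprod A w 0 0 /\
  forall y, 0 <= y * (slope w - y) -> slope_closure y.
Proof.
elim: w => [|i w [IH1 IH2]].
  rewrite /wsign big_nil wprod_nil mxE mul1r slope_nil; split=> // y.
  rewrite sub0r mulrN oppr_ge0 -expr2 => y2 e e0; exists [::].
  have : y ^+ 2 = 0 by apply/eqP; rewrite eq_le y2 sqr_ge0.
  by move/eqP; rewrite sqrf_eq0 => /eqP ->; rewrite slope_nil subr0 normr0.
have a0 : A i 0 0 != 0.
  by have := a_neq0 [:: i]; rewrite wprod_cons wprod_nil mulr1.
have pole y : 0 <= y * (slope w - y) -> A i 0 0 + A i 0 1 * y != 0.
  by move=> /IH2 /(closure_pole_neq0 i).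
have moeb y : 0 <= y * (slope w - y) -> slope_closure
    ((A i 1 0 + A i 1 1 * y) / (A i 0 0 + A i 0 1 * y)).
  by move=> /IH2 /(closure_moebius i).
have := fill_generator (i := i); have := sgn1_mul a0; have := detA i.
have := slope_cons i w; have := wprod00_cons i w; rewrite wsign_cons det2E.
move: a0 pole moeb; set sg := sgn1 (A i 0 0).
have sg2 : sg * sg = 1 by rewrite /sg; case: (sgn1P (A i 0 0)) => ->; ring.
clearbody sg; move: (slope w) IH1 => s.
set a := A i 0 0; set b := A i 0 1; set c := A i 1 0; set d := A i 1 1.
move=> IH1 a0 pole moeb Ea -> det1 sga gen.
(* Otherwise the denominator, affine in the slope, would vanish at the point [th * s] between 0 and
   [s], which lies in the closure. *)
have sgs : 0 < sg * (a + b * s).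
  rewrite ltNge; apply/negP => neg.
  have sn0 : sg != 0 by apply: contra_eq_neq sg2 => ->; rewrite mul0r eq_sym oner_neq0.
  pose th := sg * a / (sg * a - sg * (a + b * s)).
  have den : 0 < sg * a - sg * (a + b * s) by lra.
  have th0 : 0 <= th by rewrite divr_ge0 // ltW.
  have th1 : th <= 1 by rewrite ler_pdivrMr //; lra.
  have := pole (th * s).
  rewrite (_ : th * s * (s - th * s) = th * (1 - th) * s ^+ 2); last by ring.
  have nn : 0 <= th * (1 - th) * s ^+ 2.
    apply: mulr_ge0; last exact: sqr_ge0.
    by apply: mulr_ge0 => //; rewrite subr_ge0.
  move=> /(_ nn) /eqP; apply.
  apply: (mulfI sn0); rewrite mulr0.
  have -> : sg * (a + b * (th * s)) = sg * a - th * (sg * a - sg * (a + b * s)) by ring.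
  by rewrite /th divfK ?subrr // gt_eqF.
split.
  rewrite Ea [X in 0 < X](_ : _ = (sg * (a + b * s)) *
    (wsign (fun i => sgn1 (A i 0 0)) w * wprod A w 0 0)); last by ring.
  by rewrite mulr_gt0.
have as0 : a + b * s != 0 by apply: contraTneq sgs => ->; rewrite mulr0 ltxx.
set M := (c + d * s) / (a + b * s) => y yb.
have [/gen //|yb'] := between_cat (c / a) yb.
(* Between [c / a] and [M] the point [y] is pulled back by the inverse Moebius map. Its denominator
   [d - b * y] is affine and has the sign [sg] at both ends, hence at [y]. *)
have u : sg * (d - b * (c / a)) = (sg * sg) / (sg * a).
  have sn0 : sg != 0 by apply: contra_eq_neq sg2 => ->; rewrite mul0r eq_sym oner_neq0.
  rewrite -[X in _ = X * _ / _]mulr1 -det1; field; rewrite a0 sn0 //.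
have v : sg * (d - b * M) = (sg * sg) / (sg * (a + b * s)).
  have sn0 : sg != 0 by apply: contra_eq_neq sg2 => ->; rewrite mul0r eq_sym oner_neq0.
  rewrite /M -[X in _ = X * _ / _]mulr1 -det1; field; rewrite as0 sn0 //.
have u0 : 0 < sg * (d - b * (c / a)) by rewrite u sg2 mul1r invr_gt0.
have v0 : 0 < sg * (d - b * M) by rewrite v sg2 mul1r invr_gt0.
have z0 : 0 < sg * (d - b * y).
  rewrite ltNge; apply/negP => z0.
  have : (sg * (d - b * (c / a)) - sg * (d - b * y)) *
      (sg * (d - b * y) - sg * (d - b * M)) =
      (sg * sg) * (b ^+ 2 * ((y - c / a) * (M - y))) by ring.
  have : 0 <= b ^+ 2 * ((y - c / a) * (M - y)) by rewrite mulr_ge0 ?sqr_ge0.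
  rewrite sg2 mul1r => H1 H2; move: H1; rewrite -H2; nra.
have dby : d - b * y != 0 by apply: contraTneq z0 => ->; rewrite mulr0 ltxx.
pose y' := (a * y - c) / (d - b * y).
have ay' : a + b * y' = 1 / (d - b * y).
  by rewrite -det1 /y'; field.
have -> : y = (c + d * y') / (a + b * y').
  rewrite ay' /y'; apply: (mulIf (_ : 1 / (d - b * y) != 0)).
    by rewrite mul1r invr_eq0.
  rewrite divfK ?mul1r ?invr_eq0 //.
  apply: (mulIf dby); rewrite divfK // mulrDl [d * _]mulrA divfK //.
  by rewrite -[LHS]mulr1 -det1; ring.
apply: moeb.
rewrite (_ : y' * (s - y') =
  (sg * a) * (sg * (a + b * s)) * ((y - c / a) * (M - y)) / (d - b * y) ^+ 2).
  apply: divr_ge0; last exact: sqr_ge0.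
  by apply: mulr_ge0 => //; apply: mulr_ge0; exact: ltW.
rewrite [sg * a * _](_ : _ = (sg * sg) * (a * (a + b * s))); last by ring.
by rewrite sg2 /y' /M; field; rewrite dby a0 as0.
Qed.

End NearIdentity.

(** * Criteria for an invariant cone *)

Section ConeCriteria.
Variables (R : realType) (T : finType).
Implicit Types (A : T -> 'M[R]_2) (P Q Z : 'M[R]_2).

Definition pos_conjugate A := exists P Q, P * Q = 1 /\
  forall i, positive_mx (P * A i * Q) \/ positive_mx (- (P * A i * Q)).

Lemma trC2 Z Z' : \tr (Z * Z') = \tr (Z' * Z).
Proof. by rewrite -!mulmxE mxtrace_mulC. Qed.

Lemma tr_conj P Q Z : P * Q = 1 -> \tr (P * Z * Q) = \tr Z.
Proof. by move=> /inverse_comm QP; rewrite trC2 mulrA QP mul1r. Qed.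

Lemma tr_le Z : `|\tr Z| <= mnorm Z.
Proof.
rewrite tr2E (le_trans (ler_normD _ _)) // /mnorm.
have := normr_ge0 (Z 0 1); have := normr_ge0 (Z 1 0); lra.
Qed.

(** The distance is [ze ^+ 2] because the trace of [wprod A g] minus 2 equals [(mu - 1) ^+ 2 / mu],
    so that [mu - 1] is only of order [ze]. The two factors [L] in [ze] pay, in [C3], for the size
    of a generator and for its trace. *)
Lemma near_identity_cone A (L ze : R) (g : seq T) :
  (forall i, \det (A i) = 1) -> uniform_growth A -> 1 <= L ->
  (forall i, mnorm (A i) <= L) -> g <> [::] ->
  ze = 1 / (100 * L ^+ 2) -> mnorm (wprod A g - 1) <= ze ^+ 2 ->
  pos_conjugate A.
Proof.
move=> detA growth L1 LA g0 zeE gnear.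
have L2 : 1 <= L ^+ 2 by rewrite exprn_ege1.
have ze0 : 0 < ze by rewrite zeE divr_gt0 //; lra.
have zeL2 : ze * L ^+ 2 = 1 / 100 by rewrite zeE; field; lra.
have zeL : ze * L <= 1 / 100 by rewrite -zeL2 ler_pM2l // expr2 ler_peMr //; lra.
have ze1 : ze <= 1 / 100 by rewrite (le_trans _ zeL) // ler_peMr // ltW.
have ze2 : ze ^+ 2 <= ze by rewrite expr2; nra.
have trg : `|\tr (wprod A g) - 2| <= ze ^+ 2.
  rewrite (le_trans _ gnear) // (le_trans _ (tr_le _)) // raddfB /= tr2E.
  by rewrite [\tr 1]tr2E !mxE /=.
have trg2 : 2 < \tr (wprod A g).
  have := growth_trace detA growth g0; move: trg.
  by rewrite ler_norml ltr_normr => /andP[h1 h2] /orP[|] //; lra.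
have {trg} trg : \tr (wprod A g) - 2 <= ze ^+ 2.
  by move: trg; rewrite ger0_norm // subr_ge0 ltW.
have [mu [P [Q [mu1 PQ gE muE]]]] := diagonalize (det_wprod detA g) trg2.
have QP := inverse_comm PQ.
have mu0 : mu != 0 by rewrite gt_eqF // (lt_trans ltr01).
have mui : 0 < mu^-1 by rewrite invr_gt0 (lt_trans ltr01).
have mui1 : mu^-1 <= 1 by rewrite invf_le1 ?ltW // (lt_trans ltr01).
have musq : (mu - 1) ^+ 2 <= ze ^+ 2 * mu.
  have <- : (\tr (wprod A g) - 2) * mu = (mu - 1) ^+ 2 by rewrite -muE; field.
  by rewrite ler_pM2r // (lt_trans ltr01).
have mu2 : mu <= 2.
  rewrite leNgt; apply/negP => mu2.
  have : mu - 1 <= (mu - 1) ^+ 2 by rewrite expr2 ler_peMr //; lra.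
  have : ze ^+ 2 * mu <= 1 / 100 * mu by rewrite ler_wpM2r //; lra.
  lra.
have muze : mu - 1 <= 2 * ze.
  rewrite leNgt; apply/negP => H.
  have : (2 * ze) ^+ 2 < (mu - 1) ^+ 2 by rewrite ltr_pXn2r ?nnegrE //; lra.
  have : ze ^+ 2 * mu <= ze ^+ 2 * 2 by rewrite ler_wpM2l // sqr_ge0.
  have : 0 < ze ^+ 2 by rewrite exprn_gt0.
  rewrite exprMn; lra.
have beze : mu ^+ 2 - 1 <= 6 * ze.
  have -> : mu ^+ 2 - 1 = (mu - 1) * (mu + 1) by ring.
  nra.
have be0 : 0 < mu ^+ 2 - 1 by rewrite subr_gt0 exprn_egt1.
pose B := conj_fam P Q A.
have detB i : \det (B i) = 1 by rewrite det_conj.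
have growB : uniform_growth B := growth_conj PQ QP growth.
have [LB LB1 HLB] := family_bound B.
have gB : wprod B g = mat2 mu 0 0 mu^-1 by rewrite wprod_conj.
have trB i : `|B i 0 0 + B i 1 1| <= L.
  by rewrite -tr2E tr_conj // (le_trans (tr_le _)).
(* Conjugated, [wprod A g - mu^-1 *: 1] is [mu - mu^-1] times the projection onto the first axis. A
   trace thus extracts [B i 0 0] from unconjugated matrices, and no bound on [P] or [Q] is
   involved. *)
have aB i : (mu ^+ 2 - 1) * `|B i 0 0| <= 10 * L * ze.
  have E : (mu - mu^-1) * B i 0 0 = \tr (A i * (wprod A g - mu^-1 *: 1)).
    rewrite -(tr_conj _ PQ) (_ : P * (A i * _) * Q =
      B i * (P * wprod A g * Q - mu^-1 *: 1)); last first.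
      rewrite /B /conj_fam !mulrBr mulrBl -!scalerAr -scalerAl !mulr1.
      congr (_ - _); rewrite -!mulrA; congr (_ * (_ * _)).
      by rewrite [RHS]mulrA QP mul1r.
    by rewrite gE tr2E !mul2E !mxE /=; ring.
  have N : mnorm (wprod A g - mu^-1 *: 1) <= 5 * ze.
    have -> : wprod A g - mu^-1 *: 1 = (wprod A g - 1) - (mu^-1 - 1) *: 1.
      by rewrite scalerBl scale1r opprB addrA addrNK.
    rewrite (le_trans (mnormB _ _)) // mnormZ mnorm1.
    have : `|mu^-1 - 1| <= mu - 1.
      have : 2 <= mu + mu^-1 by rewrite muE ltW.
      by rewrite ler0_norm; lra.
    lra.
  have {}E : `|(mu - mu^-1) * B i 0 0| <= 5 * L * ze.
    rewrite E (le_trans (tr_le _)) // (le_trans (mnormM _ _)) //.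
    rewrite (_ : 5 * L * ze = L * (5 * ze)); last by ring.
    by rewrite ler_pM ?mnorm_ge0.
  have -> : (mu ^+ 2 - 1) * `|B i 0 0| = mu * `|(mu - mu^-1) * B i 0 0|.
    have m0 : 0 <= mu - mu^-1.
      by rewrite subr_ge0; apply: (le_trans mui1); exact: ltW.
    by rewrite normrM (ger0_norm m0); field.
  have := normr_ge0 ((mu - mu^-1) * B i 0 0); nra.
have dB i : (mu ^+ 2 - 1) * `|B i 1 1| <= 16 * L * ze.
  have : `|B i 1 1| <= L + `|B i 0 0|.
    rewrite (_ : B i 1 1 = (B i 0 0 + B i 1 1) - B i 0 0); last by ring.
    by rewrite (le_trans (ler_normB _ _)) // lerD2r.
  move=> H; have : (mu ^+ 2 - 1) * `|B i 1 1| <= (mu ^+ 2 - 1) * (L + `|B i 0 0|).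
    by rewrite ler_pM2l.
  have := aB i; have : (mu ^+ 2 - 1) * L <= 6 * ze * L by rewrite ler_wpM2r //; lra.
  lra.
have L0 : 0 <= L by lra.
have Lze : 0 <= L * ze by rewrite mulr_ge0 // ltW.
have Lze2 : (L * ze) ^+ 2 <= 1 / 10000.
  have -> : (1 : R) / 10000 = (1 / 100) ^+ 2 by field.
  by rewrite ler_pXn2r ?nnegrE //; lra.
have C1 : mu ^+ 2 - 1 <= 1 / 8 by apply: (le_trans beze); clear -ze1; lra.
have C2 i : (mu ^+ 2 - 1) ^+ 2 * `|B i 0 0 * B i 1 1 - 1| <= 1 / 8.
  have H1 : `|B i 0 0 * B i 1 1 - 1| <= `|B i 0 0| * `|B i 1 1| + 1.
    by rewrite (le_trans (ler_normB _ _)) // normrM normr1.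
  have H2 : (mu ^+ 2 - 1) ^+ 2 * `|B i 0 0 * B i 1 1 - 1| <=
    (mu ^+ 2 - 1) ^+ 2 * (`|B i 0 0| * `|B i 1 1| + 1).
    by rewrite ler_wpM2l // sqr_ge0.
  have H3 : ((mu ^+ 2 - 1) * `|B i 0 0|) * ((mu ^+ 2 - 1) * `|B i 1 1|) <=
    (10 * L * ze) * (16 * L * ze).
    by apply: ler_pM => //; rewrite mulr_ge0 // ltW.
  have H4 : (mu ^+ 2 - 1) ^+ 2 <= (6 * ze) ^+ 2.
    by rewrite ler_pXn2r ?nnegrE ?(ltW be0) // mulr_ge0 // ltW.
  have H5 : ze ^+ 2 <= (L * ze) ^+ 2.
    by rewrite exprMn ler_peMl // sqr_ge0.
  move: Lze2 H5 H4 H3; rewrite !exprMn; lra.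
have C3 i : (mu ^+ 2 - 1) * (`|B i 0 0| * `|B i 0 0 + B i 1 1|) <= 1 / 2.
  rewrite mulrA.
  have : (mu ^+ 2 - 1) * `|B i 0 0| * `|B i 0 0 + B i 1 1| <= 10 * L * ze * L.
    by apply: ler_pM => //; rewrite mulr_ge0 // ltW.
  have : 10 * L * ze * L = 10 * (ze * L ^+ 2) by ring.
  by rewrite zeL2 => ->; clear; lra.
apply: (signed_cone detA growth _ PQ mu1 gE (sg := fun i => sgn1 (B i 0 0))).
  by move=> i; apply: sgn1P.
move=> w; rewrite -(wprod_conj _ _ PQ QP).
by have [] := interval_signs detB growB LB1 HLB mu1 gB C1 C2 C3 w.
Qed.

(** Invariant under conjugation and under changing the signs of generators, as is the existence of a
    cone. *)
Definition wtrace A (w : seq T) := \tr (wprod A w) * \prod_(i <- w) \tr (A i).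

(** Multiplied by its trace, each conjugated generator has nonnegative entries, a property stable
    under products. *)
Lemma cone_trace A w : pos_conjugate A -> 0 <= wtrace A w.
Proof.
move=> [P [Q [PQ H]]]; have QP := inverse_comm PQ.
rewrite /wtrace.
set wt := fun w : seq T => \prod_(i <- w) \tr (A i).
have key v : forall k l, 0 <= wt v * (P * wprod A v * Q) k l.
  elim: v => [|i v IH].
    rewrite /wt big_nil wprod_nil mulr1 PQ => k l.
    by rewrite mul1r mxE; case: eqP.
  have pos k l : 0 <= \tr (A i) * (P * A i * Q) k l.
    rewrite -(tr_conj _ PQ) tr2E.
    case: (H i) => Hi; first by rewrite mulr_ge0 ?addr_ge0 // ltW.
    rewrite -mulrNN mulr_ge0 // ?oppr_ge0 -?mulrN.
      by have := Hi 0 0; have := Hi 1 1; rewrite !mxE; lra.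
    by have := Hi k l; rewrite mxE oppr_gt0 => /ltW.
  move=> k l; rewrite /wt big_cons -/(wt v) wprod_cons.
  have -> : P * (A i * wprod A v) * Q = (P * A i * Q) * (P * wprod A v * Q).
    by rewrite -!mulrA [Q * (P * _)]mulrA QP mul1r.
  rewrite mul2E [leRHS](_ : _ =
    (\tr (A i) * (P * A i * Q) k 0) * (wt v * (P * wprod A v * Q) 0 l) +
    (\tr (A i) * (P * A i * Q) k 1) * (wt v * (P * wprod A v * Q) 1 l)); last by ring.
  by rewrite addr_ge0 // mulr_ge0.
rewrite -(tr_conj _ PQ) tr2E mulrC mulrDr addr_ge0 //; exact: key.
Qed.

(** The trace of [wpow n g ++ w] is dominated by [mu ^+ n] times the first entry of the conjugated
    [w]. The signs of the traces thus determine the sign of this entry, nonzero by [slope_neq0]. *)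
Lemma trace_cone A (i0 : T) : (forall i, \det (A i) = 1) -> uniform_growth A ->
  (forall w, 0 <= wtrace A w) -> pos_conjugate A.
Proof.
move=> detA growth tr_ge0.
have tr_gen i : 2 < `|\tr (A i)|.
  have := @growth_trace R T A detA growth [:: i].
  by rewrite wprod_cons wprod_nil mulr1; apply.
have tr0 i : \tr (A i) != 0 by rewrite -normr_gt0 (lt_trans _ (tr_gen i)).
pose sg i := sgn1 (\tr (A i)).
have sg1 i : sg i = 1 \/ sg i = -1 := sgn1P _.
(* A square has trace above 2, and its two equal letters have total sign 1. *)
pose g := [:: i0; i0].
have trg : 2 < \tr (wprod A g).
  rewrite /g !wprod_cons wprod_nil mulr1 cayley_hamilton2 //.
  rewrite raddfB /= mxtraceZ [\tr 1]tr2E !mxE /=.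
  have := tr_gen i0; rewrite -(@ltr_pXn2r _ 2) ?nnegrE // real_normK ?num_real //.
  by rewrite !expr2; lra.
have [mu [P [Q [mu1 PQ gE _]]]] := diagonalize (det_wprod detA g) trg.
have QP := inverse_comm PQ.
apply: (signed_cone detA growth sg1 PQ mu1 gE) => w.
pose B := conj_fam P Q A.
have detB i : \det (B i) = 1 by rewrite det_conj.
have growB : uniform_growth B := growth_conj PQ QP growth.
have [LB LB1 HLB] := family_bound B.
have gB : wprod B g = mat2 mu 0 0 mu^-1 by rewrite wprod_conj.
have := slope_neq0 detB growB LB1 HLB mu1 gB w; rewrite wprod_conj // => a0.
have tr_sg v : 0 <= wsign sg v * \tr (wprod A v).
  have E : \prod_(i <- v) \tr (A i) = wsign sg v * \prod_(i <- v) `|\tr (A i)|.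
    rewrite /wsign -big_split /=; apply: eq_bigr => i _.
    rewrite -sgn1_mulE // mulrA -/(sg i) (_ : sg i * sg i = 1) ?mul1r //.
    by case: (sg1 i) => ->; ring.
  have pos : 0 < \prod_(i <- v) `|\tr (A i)|.
    by rewrite prodr_gt0 // => i _; rewrite normr_gt0.
  have := tr_ge0 v; rewrite /wtrace E mulrA pmulr_lge0 //.
  by rewrite mulrC.
have nsg i : `|sg i| = 1 by case: (sg1 i) => ->; rewrite ?normrN normr1.
have wg n : wsign sg (wpow n g ++ w) = wsign sg w.
  elim: n => [|n IH] //; rewrite /wpow /= !wsign_cons IH mulrA.
  by rewrite (_ : sg i0 * sg i0 = 1) ?mul1r //; case: (sg1 i0) => ->; ring.
set a := (P * wprod A w * Q) 0 0 in a0 *.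
set d := (P * wprod A w * Q) 1 1.
have trn n : \tr (wprod A (wpow n g ++ w)) = mu ^+ n * a + (mu^-1) ^+ n * d.
  have mu0 : mu != 0 by rewrite gt_eqF // (lt_trans ltr01).
  rewrite -(tr_conj _ PQ) -(wprod_conj _ _ PQ QP) wprod_cat.
  rewrite (wprod_pow_diag n mu0 gB) wprod_conj // /a /d.
  by move: (P * wprod A w * Q) => X; rewrite tr2E !mul2E !mat2E; ring.
have wa0 : wsign sg w * a != 0.
  by rewrite mulf_neq0 // -normr_gt0 norm_wsign.
rewrite ltNge; apply/negP => neg.
have neg' : 0 < - (wsign sg w * a) by rewrite oppr_gt0 lt_neqAle wa0.
have [n Hn] := linear_lt_exp `|d| 0 mu1 neg'.
have := Hn n (leqnn _); rewrite mul0r addr0.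
have := tr_sg (wpow n g ++ w); rewrite wg trn mulrDr.
have : wsign sg w * (mu^-1 ^+ n * d) <= `|d|.
  rewrite (le_trans (ler_norm _)) // !normrM norm_wsign // mul1r ler_piMl //.
  have mui : 0 < mu^-1 by rewrite invr_gt0 (lt_trans ltr01).
  by rewrite normrX gtr0_norm // exprn_ile1 // ?ltW // invf_lt1 // (lt_trans ltr01).
lra.
Qed.

End ConeCriteria.

(** * Topology of the loci *)

Section RealContinuity.
Variables (R : realType) (T : topologicalType).
Implicit Types f g : T -> R.

Lemma continuous_add f g : continuous f -> continuous g ->
  continuous (fun x => f x + g x).
Proof. by move=> cf cg x; apply: (@continuousD _ R^o _ f g); [exact: cf|exact: cg]. Qed.

Lemma continuous_mul f g : continuous f -> continuous g ->
  continuous (fun x => f x * g x).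
Proof. by move=> cf cg x; apply: (@continuousM _ _ f g); [exact: cf|exact: cg]. Qed.

Lemma continuous_opp f : continuous f -> continuous (fun x => - f x).
Proof. by move=> cf x; apply: (@continuousN _ R^o _ f); exact: cf. Qed.

Lemma continuous_abs f : continuous f -> continuous (fun x => `|f x|).
Proof.
move=> cf x; apply: (@continuous_comp _ _ _ f (fun y : R => `|y|)).
  exact: cf.
exact: (@norm_continuous _ R^o).
Qed.

End RealContinuity.

Lemma mnorm_lt (R : realType) (Z Z' : 'M[R]_2) (e : R) :
  (forall k l, `|Z k l - Z' k l| < e / 4) -> mnorm (Z - Z') < e.
Proof.
move=> H; rewrite /mnorm !mxE.
move: (H 0 0) (H 0 1) (H 1 0) (H 1 1); lra.
Qed.

Section Loci.
Variables (R : realType) (N : nat).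
Implicit Types (A : SL2N R N).

Definition gens A : 'I_N -> 'M[R]_2 := fun i => mx (A i).

Lemma det_gens A i : \det (gens A i) = 1.
Proof. exact: set_valP (A i). Qed.

Lemma hyperbolic_growth (nrm : 'M[R]_2 -> R) A :
  is_matrix_norm nrm -> uniformly_hyperbolic nrm A -> uniform_growth (gens A).
Proof.
move=> [tri sc _] [lam [C [lam1 C0 H]]].
pose E00 : 'M[R]_2 := mat2 1 0 0 0; pose E01 : 'M[R]_2 := mat2 0 1 0 0.
pose E10 : 'M[R]_2 := mat2 0 0 1 0; pose E11 : 'M[R]_2 := mat2 0 0 0 1.
pose c := `|nrm E00| + `|nrm E01| + `|nrm E10| + `|nrm E11| + 1.
have c0 : 0 < c by rewrite /c ltr_wpDl // !addr_ge0.
have nrm_le M : nrm M <= c * mnorm M.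
  have -> : nrm M =
      nrm (M 0 0 *: E00 + (M 0 1 *: E01 + (M 1 0 *: E10 + M 1 1 *: E11))).
    by congr nrm; apply: matrix2P; rewrite !mxE /=; ring.
  rewrite (le_trans (tri _ _)) // sc.
  have := tri (M 0 1 *: E01) (M 1 0 *: E10 + M 1 1 *: E11).
  have := tri (M 1 0 *: E10) (M 1 1 *: E11).
  rewrite !sc /c /mnorm.
  have := ler_norm (nrm E00); have := ler_norm (nrm E01).
  have := ler_norm (nrm E10); have := ler_norm (nrm E11).
  move: (normr_ge0 (nrm E00)) (normr_ge0 (nrm E01)) (normr_ge0 (nrm E10))
    (normr_ge0 (nrm E11)) (normr_ge0 (M 0 0)) (normr_ge0 (M 0 1))
    (normr_ge0 (M 1 0)) (normr_ge0 (M 1 1)).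
  move: `|nrm E00| `|nrm E01| `|nrm E10| `|nrm E11|.
  move: (nrm E00) (nrm E01) (nrm E10) (nrm E11).
  move: `|M 0 0| `|M 0 1| `|M 1 0| `|M 1 1|.
  move=> m0 m1 m2 m3 e0 e1 e2 e3 f0 f1 f2 f3 *.
  have B (m e f : R) : 0 <= m -> e <= f -> m * e <= m * f by move=> *; rewrite ler_wpM2l.
  have := B m0 e0 (f0 + f1 + f2 + f3 + 1); have := B m1 e1 (f0 + f1 + f2 + f3 + 1).
  have := B m2 e2 (f0 + f1 + f2 + f3 + 1); have := B m3 e3 (f0 + f1 + f2 + f3 + 1).
  lra.
have lam0 : 0 < lam by rewrite (lt_trans ltr01).
(* The 2 is the norm of the empty product; [lam] is divided out because a word of length [n.+1] is
   only granted [lam ^+ n]. *)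
exists lam, (Num.min 2 (C / (c * lam))); split => //.
  by rewrite lt_min ltr0n divr_gt0 // mulr_gt0.
case=> [|x s].
  by rewrite expr0 mulr1 wprod_nil mnorm1 ge_min lexx.
pose t := x :: s.
(* The sequence lists the word backwards, as the last index gives the leftmost factor; indices
   beyond [size s] do not enter the product. *)
have := H (fun j => nth x t (size s - j)%N) (size s).
have -> : \prod_(k < (size s).+1) mx (A (nth x t (size s - (size s - k))%N)) =
    wprod (gens A) t.
  rewrite /wprod (big_nth x) big_mkord; apply: eq_bigr => k _.
  by rewrite subKn // -ltnS.
move=> H1; have {}H1 := le_trans H1 (nrm_le _).
apply: (@le_trans _ _ (C / (c * lam) * lam ^+ (size s).+1)).
  by rewrite ler_wpM2r ?exprn_ge0 ?ge_min ?lexx ?orbT // ltW.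
have -> : C / (c * lam) * lam ^+ (size s).+1 = C * lam ^+ size s / c.
  by rewrite exprS; field; rewrite (gt_eqF c0) (gt_eqF lam0).
by rewrite ler_pdivrMr // [leRHS]mulrC.
Qed.

(** Exchanging the axes corrects a negative determinant of [P] and keeps positivity; a scaling then
    brings the determinant to 1. *)
Lemma SL2_conjugate A : pos_conjugate (gens A) ->
  exists B : SL2 R, forall i : 'I_N,
    let M := mx B * mx (A i) * (mx B)^-1 in
    positive_mx M \/ positive_mx (- M).
Proof.
suff key P Q : P * Q = 1 -> 0 < \det P ->
    (forall i, positive_mx (P * gens A i * Q) \/
               positive_mx (- (P * gens A i * Q))) ->
    exists B : SL2 R, forall i : 'I_N,
      let M := mx B * mx (A i) * (mx B)^-1 in
      positive_mx M \/ positive_mx (- M).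
  move=> [P [Q [PQ H]]].
  have dPQ : \det P * \det Q = 1 by rewrite -detM2 PQ det1.
  have [dP|dP|dP] := ltgtP (\det P) 0.
  - pose J : 'M[R]_2 := mat2 0 1 1 0.
    have JJ : J * J = 1.
      by apply: matrix2P; rewrite mul2E !mat2E !mxE /=; ring.
    apply: (key (J * P) (Q * J)).
    + by rewrite -!mulrA [P * (Q * _)]mulrA PQ mul1r.
    + by rewrite detM2 [\det J]det2E !mat2E; lra.
    + have JE M : J * M * J = mat2 (M 1 1) (M 1 0) (M 0 1) (M 0 0).
        by apply: matrix2P; rewrite !mul2E !mat2E; ring.
      have Jpos M : positive_mx M -> positive_mx (J * M * J).
        move=> pM; rewrite JE; apply: ord2P; apply: ord2P; rewrite mat2E;
        exact: pM.
      move=> i.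
      have -> : J * P * gens A i * (Q * J) = J * (P * gens A i * Q) * J.
        by rewrite !mulrA.
      by case: (H i) => /Jpos; [left|right; rewrite -mulNr -mulrN].
  - exact: (key P Q).
  - by move: dPQ; rewrite dP mul0r => /esym/eqP; rewrite oner_eq0.
move=> PQ dP H.
pose r := Num.sqrt (\det P).
have r0 : 0 < r by rewrite sqrtr_gt0.
have rr : r ^+ 2 = \det P by rewrite sqr_sqrtr // ltW.
have dB : \det (r^-1 *: P) = 1.
  by rewrite detZ -rr exprVn mulVf // expf_neq0 // gt_eqF.
have Bin : [set M : 'M[R]_2 | \det M = 1] (r^-1 *: P) by [].
exists (exist _ (r^-1 *: P) (mem_set Bin)) => i.
have BQ : (r^-1 *: P)^-1 = r *: Q.
  have E : (r^-1 *: P) * (r *: Q) = 1.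
    by rewrite -scalerAl -scalerAr scalerA mulVf ?gt_eqF // PQ scale1r.
  have U : (r^-1 *: P) \is a GRing.unit.
    by apply/unitrP; exists (r *: Q); split => //; exact: inverse_comm.
  by rewrite -[RHS](mulKr U) E mulr1.
rewrite /= /mx /= BQ.
have -> : (r^-1 *: P) * \val (A i) * (r *: Q) = P * gens A i * Q.
  by rewrite -!scalerAl -!scalerAr scalerA mulVf ?gt_eqF // scale1r.
exact: H.
Qed.

Lemma entry_continuous i k l : continuous (fun A => gens A i k l).
Proof.
move=> A.
apply: (@continuous_comp _ _ _ (fun A : SL2N R N => mx (A i))
  (fun M : 'M[R]_2 => M k l)); last exact: coord_continuous.
apply: (@continuous_comp _ _ _ (fun A : SL2N R N => A i) (@mx R)).
  exact: (@proj_continuous _ (fun _ : 'I_N => SL2 R) i).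
exact: initial_continuous.
Qed.

Lemma wprod_continuous w k l : continuous (fun A => wprod (gens A) w k l).
Proof.
elim: w k l => [|i w IH] k l.
  have -> : (fun A0 => wprod (gens A0) [::] k l) = cst ((1 : 'M[R]_2) k l).
    by apply/funext => A0; rewrite wprod_nil.
  exact: cst_continuous.
have -> : (fun A0 => wprod (gens A0) (i :: w) k l) =
   (fun A0 => gens A0 i k 0 * wprod (gens A0) w 0 l +
              gens A0 i k 1 * wprod (gens A0) w 1 l).
  by apply/funext => A0; rewrite wprod_cons mul2E.
by apply: continuous_add; apply: continuous_mul; (exact: entry_continuous || exact: IH).
Qed.

Lemma mnorm_continuous (f : SL2N R N -> 'M[R]_2) :
  (forall k l, continuous (fun A => f A k l)) -> continuous (fun A => mnorm (f A)).
Proof.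
move=> cf; rewrite /mnorm.
by do 3?[apply: continuous_add]; apply: continuous_abs; exact: cf.
Qed.

Lemma wtrace_continuous w : continuous (fun A => wtrace (gens A) w).
Proof.
have tr (f : SL2N R N -> 'M[R]_2) : (forall k l, continuous (fun A => f A k l)) ->
    continuous (fun A => \tr (f A)).
  move=> cf; have -> : (fun A => \tr (f A)) = (fun A => f A 0 0 + f A 1 1).
    by apply/funext => A; rewrite tr2E.
  exact: continuous_add.
rewrite /wtrace; apply: continuous_mul; first exact/tr/wprod_continuous.
elim: w => [|i w IH].
  under [X in continuous X]eq_fun do rewrite big_nil.
  exact: cst_continuous.
under [X in continuous X]eq_fun do rewrite big_cons.
by apply: continuous_mul => //; exact/tr/entry_continuous.
Qed.

Lemma trace_closed : closed [set A | forall w, 0 <= wtrace (gens A) w].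
Proof.
have -> : [set A | forall w, 0 <= wtrace (gens A) w] =
    \bigcap_(w in [set: seq 'I_N]) ((fun A => wtrace (gens A) w) @^-1` [set x | 0 <= x]).
  by apply/seteqP; split => A H w; [move=> _; exact: H|exact: (H w)].
apply: closed_bigI => w _.
by apply: closed_comp => [A _|]; [exact: wtrace_continuous|exact: closed_ge].
Qed.

Lemma pos_conjugate_open : open [set A | pos_conjugate (gens A)].
Proof.
rewrite openE => A [P [Q [PQ H]]]; rewrite /interior.
have cont i k l : continuous (fun A0 => (P * gens A0 i * Q) k l).
  have -> : (fun A0 => (P * gens A0 i * Q) k l) = (fun A0 =>
     (P k 0 * gens A0 i 0 0 + P k 1 * gens A0 i 1 0) * Q 0 l +
     (P k 0 * gens A0 i 0 1 + P k 1 * gens A0 i 1 1) * Q 1 l).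
    by apply/funext => A0; rewrite !mul2E.
  by apply: continuous_add; apply: continuous_mul; try exact: cst_continuous;
    apply: continuous_add; apply: continuous_mul;
    (exact: cst_continuous || exact: entry_continuous).
have near_pos (f : SL2N R N -> 'M[R]_2) :
    (forall k l, continuous (fun A0 => f A0 k l)) -> positive_mx (f A) ->
    \forall A0 \near A, positive_mx (f A0).
  move=> cf fA.
  have pos k l : \forall A0 \near A, 0 < f A0 k l.
    apply: (cf k l A [set x | 0 < x]); apply: open_nbhs_nbhs.
    by split; [exact: open_gt|exact: fA].
  apply: filterS (filterI (filterI (pos 0 0) (pos 0 1)) (filterI (pos 1 0) (pos 1 1))).
  move=> A0 [[p00 p01] [p10 p11]].
  by apply: (@ord2P (fun k => forall l, 0 < f A0 k l)); apply: ord2P.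
have near_i i : \forall A0 \near A, positive_mx (P * gens A0 i * Q) \/
    positive_mx (- (P * gens A0 i * Q)).
  case: (H i) => Hi.
    by apply: filterS (near_pos _ (cont i) Hi) => A0; left.
  have cN : forall k l, continuous (fun A0 => (- (P * gens A0 i * Q)) k l).
    move=> k l.
    have -> : (fun A0 => (- (P * gens A0 i * Q)) k l) =
        (fun A0 => - (P * gens A0 i * Q) k l).
      by apply/funext => A0; rewrite mxE.
    exact/continuous_opp/cont.
  by apply: filterS (near_pos _ cN Hi) => A0; right.
have near_all : \forall A0 \near A, forall i,
    positive_mx (P * gens A0 i * Q) \/ positive_mx (- (P * gens A0 i * Q)).
  exact: (@filter_forall _ _ (fun i => [set A0 | positive_mx (P * gens A0 i * Q) \/
    positive_mx (- (P * gens A0 i * Q))]) (nbhs A) _ near_i).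
by apply: filterS near_all => A0 H0; exists P, Q.
Qed.

Lemma principal_component (nrm : 'M[R]_2 -> R) A :
  is_matrix_norm nrm -> (0 < N)%N -> hyperbolic_locus nrm N A ->
  pos_conjugate (gens A) -> principal_locus nrm N A.
Proof.
move=> nn N0 hA pA.
pose H := connected_component (hyperbolic_locus nrm N) A.
have HA : H A by exact: connected_component_refl.
have Hhyp B : H B -> hyperbolic_locus nrm N B by exact: connected_component_sub.
have pos : forall B, H B -> pos_conjugate (gens B).
  suff <- : [set B | H B /\ pos_conjugate (gens B)] = H by move=> B [].
  apply: (@component_connected _ (hyperbolic_locus nrm N) A).
  - by exists A.
  - by exists [set B | pos_conjugate (gens B)] => //; exact: pos_conjugate_open.
  - exists [set B | forall w, 0 <= wtrace (gens B) w]; first exact: trace_closed.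
    apply/seteqP; split => B [HB pB]; split => //; first by move=> w; exact: cone_trace.
    apply: (trace_cone (Ordinal N0) (@det_gens B)) => //.
    exact: hyperbolic_growth nn (Hhyp B HB).
exists H => //; split; first by exists A.
by move=> B /pos; exact: SL2_conjugate.
Qed.

End Loci.

Theorem theorem1p5 (R : realType) (nrm : 'M[R]_2 -> R)
    (nrm_norm : is_matrix_norm nrm) (N : nat) (N_gt1 : (1 < N)%N) :
  closure (hyperbolic_locus nrm N `\` principal_locus nrm N)
    `<=` semidiscrete_inverse_free_locus R N.
Proof.
move=> A clA; suff key : ~ forall e : R, 0 < e ->
    exists2 s : seq 'I_N, s <> [::] & mnorm (wprod (gens A) s - 1) < e.
  split=> H; apply: key => e e0.
    have e4 : 0 < e / 4 by rewrite divr_gt0.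
    have [M [_ [s s0 ->] Ms]] := H _ (nbhsx_ballx (1 : 'M[R]_2) _ e4).
    exists s; first exact/eqP.
    by apply: mnorm_lt => k l; rewrite distrC; exact: Ms.2.
  case: H => s s0 E; exists s; first exact/eqP.
  rewrite /wprod /gens -E subrr /mnorm !mxE normr0; lra.
move=> near1.
have [L L1 LA] := family_bound (gens A).
(* The slack makes [L'] a bound for all tuples near [A]. So [ze] and the word [s] are fixed before
   the hyperbolic tuple [A0] is chosen; [A] itself may fail to be hyperbolic. *)
pose L' := L + 1.
have L'1 : 1 <= L' by rewrite /L'; lra.
pose ze : R := 1 / (100 * L' ^+ 2).
have ze0 : 0 < ze by rewrite divr_gt0 // mulr_gt0 // exprn_gt0 //; lra.
have [s s0 As] := near1 (ze ^+ 2) (exprn_gt0 2 ze0).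
have n1 : \forall A0 \near A, mnorm (wprod (gens A0) s - 1) < ze ^+ 2.
  have c k l : continuous (fun A0 : SL2N R N => (wprod (gens A0) s - 1) k l).
    have -> : (fun A0 : SL2N R N => (wprod (gens A0) s - 1) k l) =
        (fun A0 => wprod (gens A0) s k l + (- (1 : 'M[R]_2) k l)).
      by apply/funext => A0; rewrite !mxE.
    apply: continuous_add; first exact: wprod_continuous.
    exact: cst_continuous.
  apply: (@mnorm_continuous _ _ _ c A [set x | x < ze ^+ 2]); apply: open_nbhs_nbhs.
  by split; [exact: open_lt|].
have n2 : \forall A0 \near A, forall i, mnorm (gens A0 i) < L'.
  apply: (@filter_forall _ _ (fun i => [set A0 | mnorm (gens A0 i) < L']) (nbhs A) _ _).
  move=> i.
  apply: (@mnorm_continuous _ _ _ (@entry_continuous _ _ i) A [set x | x < L']).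
  apply: open_nbhs_nbhs; split; first exact: open_lt.
  by rewrite /L' /=; have := LA i; lra.
have [A0 [[hA0 npA0] [A0s A0L]]] := clA _ (filterI n1 n2).
apply: npA0; apply: principal_component => //; first exact: ltnW.
apply: (near_identity_cone (L := L') (ze := ze) (g := s)) => //.
- exact: det_gens.
- exact: hyperbolic_growth nrm_norm hA0.
- by move=> i; exact: ltW.
- exact: ltW.
Qed.
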